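(* Let $(\mu_k)_{k=1}^\infty$ be a divergent, strictly increasing sequence of positive numbers such that the set $\mathcal S=\{\mu_k:k\in\mathbb N\}$ satisfies $x+y\in\mathcal S$ for all $x,y\in\mathcal S$ and $x+1\in\mathcal S$ for all $x\in\mathcal S$. Let $(n_k)_{k=1}^\infty$ be a (not necessarily strictly) increasing sequence in $\mathbb N$. Assume there is $T_f\ge 0$ such that $f$ is continuous on $[T_f,\infty)$, and that $$f(t)\sim\sum_{k=1}^\infty p_k(\mathcal L_{n_k}(t))t^{-\mu_k},\quad\text{where }p_k\in\mathcal P(n_k,\mathbb R^n).$$ Let $T_0\ge 0$ and let $y\in C^1((T_0,\infty),\mathbb R^n)$ be a solution of $y'=-Ay+G(y)+f(t)$ on $(T_0,\infty)$ with $y(t)\to 0$ as $t\to\infty$. Then $y(t)$ admits the asymptotic expansion $$y(t)\sim\sum_{k=1}^\infty q_k(\mathcal L_{n_k}(t))t^{-\mu_k},$$ where $q_k\in\mathcal P(n_k,\mathbb R^n)$ is defined by $q_1=A^{-1}p_1$ and, for $k\ge 2$, $$q_k=A^{-1}\Big(\sum_{m\ge 2}\ \sum_{\mu_{j_1}+\mu_{j_2}+\cdots+\mu_{j_m}=\mu_k}\mathcal G_m(q_{j_1},q_{j_2},\ldots,q_{j_m})+p_k+\chi_k\Big),$$ with $\chi_k\in\mathcal P(n_k,\mathbb R^n)$ given, for $z=(z_1,z_2,\ldots,z_{n_k})\in(0,\infty)^{n_k}$, by $$\chi_k(z)=\begin{cases}\displaystyle\mu_\lambda q_\lambda(z)-\sum_{j=1}^{n_\lambda}\frac{1}{z_1z_2\cdots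 z_{j-1}}\cdot\frac{\partial q_\lambda(z)}{\partial z_j},&\text{if there is an integer }\lambda\ge 1\text{ such that }\mu_\lambda+1=\mu_k,\\ 0,&\text{otherwise.}\end{cases}$$
   Context: Notation: $\mathbb N=\{1,2,\ldots\}$, $|\cdot|$ is the Euclidean norm on $\mathbb R^n$, $n\in\mathbb N$ fixed. For functions of $t$, $g(t)=\mathcal O(h(t))$ means there are $T,C>0$ with $|g(t)|\le Ch(t)$ for all $t\ge T$. Empty sums are $0$ and empty products are $1$. Sums over $\mu_{j_1}+\cdots+\mu_{j_m}=\mu_k$ run over all indices $j_1,\ldots,j_m\ge 1$ satisfying the equality. Iterated logarithms: $L_0(t)=t$, $L_{m+1}(t)=\ln(L_m(t))$ (for $t$ sufficiently large), and $\mathcal L_k(t)=(L_1(t),L_2(t),\ldots,L_k(t))$ for $k\in\mathbb N$ and $t$ sufficiently large. For $z\in(0,\infty)^k$ and $\alpha\in\mathbb R^k$, $z^\alpha=\prod_{j=1}^kz_j^{\alpha_j}$. For a real linear space $X$, $\mathcal P(k,X)$ is the set of functions $p:(0,\infty)^k\to X$ of the form $p(z)=\sum_{\alpha\in I}c_\alpha z^\alpha$ with $I\subset\mathbb R^k$ non-empty and finite and $c_\alpha\in X$. For $k<m$, $p\in\mathcal P(k,X)$ is identified with the element of $\mathcal P(m,X)$ given by $(z_1,\ldots,z_m)\mapsto p(z_1,\ldots,z_k)$; this identification is used to regard $q_{j_i}$ and $q_\lambda$ in the recursion as elements of $\mathcal P(n_k,\mathbb R^n)$. Standing assumptions on $y'=-Ay+G(y)+f(t)$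 in $\mathbb R^n$: $A$ is a constant real $n\times n$ matrix which is diagonalizable with positive eigenvalues (i.e. $A=S^{-1}A_0S$ with $S$ invertible and $A_0$ diagonal with positive entries). $G:\mathbb R^n\to\mathbb R^n$ is locally Lipschitz, and there are functions $G_m:\mathbb R^n\to\mathbb R^n$, $m\ge 2$, each a homogeneous polynomial of degree $m$, such that for every $N\ge 2$ there exists $\delta>0$ with $|G(y)-\sum_{m=2}^NG_m(y)|=\mathcal O(|y|^{N+\delta})$ as $y\to 0$. For each $m\ge 2$, $\mathcal G_m$ is a (fixed) $m$-linear mapping from $(\mathbb R^n)^m$ to $\mathbb R^n$ with $G_m(y)=\mathcal G_m(y,y,\ldots,y)$ for all $y\in\mathbb R^n$. The forcing $f$ is a function from $(0,\infty)$ to $\mathbb R^n$. Asymptotic expansion: $g(t)\sim\sum_{k=1}^\infty p_k(\mathcal L_{n_k}(t))t^{-\gamma_k}$, with $(\gamma_k)$ a divergent, strictly increasing sequence of positive numbers and $p_k\in\mathcal P(n_k,\mathbb R^n)$, means that for each $N\in\mathbb N$ there is $\mu>\gamma_N$ with $|g(t)-\sum_{k=1}^Np_k(\mathcal L_{n_k}(t))t^{-\gamma_k}|=\mathcal O(t^{-\mu})$. *)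

(* Defs.v *)
From HB Require Import structures.
From mathcomp Require Import all_boot all_order all_algebra finmap.
From mathcomp Require Import all_classical all_reals all_analysis.
From mathcomp Require mpoly.

Set Implicit Arguments.
Unset Strict Implicit.
Unset Printing Implicit Defensive.

Import Order.TTheory GRing.Theory Num.Theory.
Import numFieldNormedType.Exports.

Local Open Scope classical_set_scope.
Local Open Scope ring_scope.

(* All sequences are indexed from 0: index [k] here is index [k + 1] in the
   usual numbering from 1 (for [mu], [nn], [p], [q], and for the coordinates
   of vectors).  Only the degrees [m] of [Gm m] and [GG m] are not shifted. *)

(* The library norm [`|_|] on matrices is the maximum norm. *)
Definition enorm (R : realType) (n : nat) (x : 'cV[R]_n) : R :=
  Num.sqrt (\sum_(i < n) x i 0 ^+ 2).

Definition bigO_pinfty (R : realType) (n : nat) (g : R -> 'cV[R]_n)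
    (h : R -> R) : Prop :=
  exists T C : R, [/\ 0 < T, 0 < C &
    forall t : R, T <= t -> enorm (g t) <= C * h t].

(* [ln] is total with [ln x = 0] for [x <= 0]; the iterates below have their
   usual meaning for large [t]. *)
Definition iterlog (R : realType) (m : nat) (t : R) : R := iter m (@ln R) t.

Definition logvec (R : realType) (k : nat) (t : R) : 'rV[R]_k :=
  \row_(j < k) iterlog j.+1 t.

Definition orthant (R : realType) (k : nat) : set 'rV[R]_k :=
  [set z | forall j : 'I_k, 0 < z 0 j].

Definition monom (R : realType) (k : nat) (z a : 'rV[R]_k) : R :=
  \prod_(j < k) z 0 j `^ a 0 j.

(* Functions on the open orthant are total functions on ['rV_k] of which only
   the values on the orthant matter. *)
Definition powerlike (R : realType) (k : nat) (X : lmodType R)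
    (p : 'rV[R]_k -> X) : Prop :=
  exists (I : {fset 'rV[R]_k}) (c : 'rV[R]_k -> X),
    I != fset0 /\
    forall z, orthant z -> p z = \sum_(a <- I) monom z a *: c a.

(* First [k] coordinates of [z], to be used with [k <= m]; the padding value 1
   is then never used. *)
Definition trunc_vars (R : realType) (m k : nat) (z : 'rV[R]_m) : 'rV[R]_k :=
  \row_(j < k) oapp (z 0) 1 (insub (val j)).

(* Identification of a function of [k] variables with a function of [m >= k]
   variables. *)
Definition lift_vars (R : realType) (X : Type) (k m : nat)
    (p : 'rV[R]_k -> X) : 'rV[R]_m -> X :=
  fun z => p (trunc_vars k z).

Definition asym_expansion (R : realType) (n : nat) (g : R -> 'cV[R]_n)
    (d : nat -> nat) (p : forall k : nat, 'rV[R]_(d k) -> 'cV[R]_n)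
    (gamma : nat -> R) : Prop :=
  forall N : nat, exists2 mu : R, gamma N < mu &
    bigO_pinfty
      (fun t => g t - \sum_(k < N.+1) t `^ (- gamma k) *: p k (logvec (d k) t))
      (fun t => t `^ (- mu)).

Definition diagonalizable_pos (R : realType) (n : nat) (A : 'M[R]_n) : Prop :=
  exists (S : 'M[R]_n) (a : 'rV[R]_n),
    [/\ S \in unitmx, forall i, 0 < a 0 i & A = invmx S *m diag_mx a *m S].

Definition locally_lipschitz (R : realType) (n : nat)
    (G : 'cV[R]_n -> 'cV[R]_n) : Prop :=
  forall x0 : 'cV[R]_n, exists (U : set 'cV[R]_n) (K : R), nbhs x0 U /\
    forall x y, U x -> U y -> enorm (G x - G y) <= K * enorm (x - y).

(* [mpoly] cannot be imported together with the analysis library, hence the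
   qualified names; the condition on the support is [P i \is m.-homog]. *)
Definition homogeneous_poly_map (R : realType) (n m : nat)
    (F : 'cV[R]_n -> 'cV[R]_n) : Prop :=
  exists P : 'I_n -> mpoly.mpoly n R,
    (forall i, all [pred a | mpoly.mdeg a == m] (mpoly.msupp (P i))) /\
    forall (y : 'cV[R]_n) (i : 'I_n), F y i 0 = mpoly.meval (fun j => y j 0) (P i).

Definition multilinear_map (R : realType) (n m : nat)
    (F : ('I_m -> 'cV[R]_n) -> 'cV[R]_n) : Prop :=
  forall (v : 'I_m -> 'cV[R]_n) (i : 'I_m),
    linear (fun x : 'cV[R]_n => F (dfwith v i x)).

Definition nonlin_expansion (R : realType) (n : nat)
    (G : 'cV[R]_n -> 'cV[R]_n) (Gm : nat -> 'cV[R]_n -> 'cV[R]_n) : Prop :=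
  forall N : nat, (2 <= N)%N ->
    exists delta C : R, [/\ 0 < delta, 0 < C &
      \forall y \near (0 : 'cV[R]_n),
        enorm (G y - \sum_(2 <= m < N.+1) Gm m y)
          <= C * enorm y `^ (N%:R + delta)].

Definition divergent_positive_increasing (R : realType) (mu : nat -> R) : Prop :=
  [/\ forall k, 0 < mu k,
      {homo mu : i j / (i < j)%N >-> i < j} &
      mu k @[k --> \oo] --> +oo].

(* The index [l] with [mu l + 1 = mu k] is unique when [mu] is strictly
   increasing. *)
Definition chi (R : realType) (n : nat) (mu : nat -> R) (nn : nat -> nat)
    (q : forall k : nat, 'rV[R]_(nn k) -> 'cV[R]_n) (k : nat)
    (z : 'rV[R]_(nn k)) : 'cV[R]_n :=
  if pselect (exists l : nat, mu l + 1 = mu k) is left e then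
    let l := sval (cid e) in
    let ql : 'rV[R]_(nn k) -> 'cV[R]_n := lift_vars (q l) in
    mu l *: ql z
      - \sum_(j < nn k | (j < nn l)%N)
          (\prod_(i < nn k | (i < j)%N) z 0 i)^-1 *: 'D_(delta_mx 0 j) ql z
  else 0.

(* [\sum_(_ \in _)] is the sum over a set of a finitely supported family.  Both
   sums are finite when [mu] is positive, strictly increasing and divergent, and
   then only indices smaller than [k] occur on the right, so that these
   equations determine all [q k] on the open orthants. *)
Definition coeff_recursion (R : realType) (n : nat) (A : 'M[R]_n)
    (GG : forall m : nat, ('I_m -> 'cV[R]_n) -> 'cV[R]_n)
    (mu : nat -> R) (nn : nat -> nat)
    (p q : forall k : nat, 'rV[R]_(nn k) -> 'cV[R]_n) : Prop :=
  (forall z, orthant z -> q 0%N z = invmx A *m p 0%N z) /\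
  (forall k, (0 < k)%N -> forall z, orthant z ->
     q k z = invmx A *m
       (\sum_(m \in [set m : nat | (2 <= m)%N])
          \sum_(j \in [set j : {ffun 'I_m -> nat} |
                         \sum_(i < m) mu (j i) = mu k])
            GG m (fun i => lift_vars (q (j i)) z)
        + p k z + chi mu q z)).

(* Main.v *)
Require Import Defs.
From HB Require Import structures.
From mathcomp Require Import all_boot all_order all_algebra finmap.
From mathcomp Require Import all_classical all_reals all_analysis.
From mathcomp Require Import ring lra.

(** The theorem is a statement about one scale: g has [decay] nu when it is
    O(t^(e - nu)) for every e > 0. The loss e absorbs constants and all powers of
    iterated logarithms, so a power-like function of the logarithms has decay 0, and
    decays add up in products. By [asym_expansionP], the expansion of y says that,
    for every N, the remainder of y after its first N terms has decay mu N.

    This is proved by induction on N ([remainder_decay]). Let Z be the sum of the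
    first N + 1 terms and u = y - Z. By the differential equation and the recursion,
    u' + A u is a sum of four parts.
    - The difference between G(y) and the Taylor polynomial of G at Z. By the induction
      hypothesis y - Z has decay mu N; since all degrees are at least 2, the
      nonlinearity improves this to mu N + mu 0 ([nonlin_decay]), which is an
      exponent beyond mu N, hence at least mu (N + 1).
    - The terms of the Taylor polynomial at Z that the recursion does not cancel,
      whose exponents are sums of exponents ([nonlin_sum_decay]).
    - The remainder of f after N + 1 terms.
    - The derivatives of the terms of Z that chi does not cancel, whose exponents
      are mu k + 1 ([shift_sum_decay]).
    The set of exponents is closed under addition and under adding 1, so an
    uncancelled exponent is again one of the mu k, with k > N. All four parts thus
    have decay mu (N + 1).

    It remains to pass from u' + A u to u. An energy estimate in coordinates that
    diagonalize A shows that u decays like u' + A u ([damped_system_decay]): the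
    positive eigenvalues damp u exponentially, and powers of t vary too slowly to
    notice. The estimate tolerates a perturbation of size eta |u| with eta small.
    This gives the start of the induction, y itself having decay mu 0: as y tends to
    0, the at least quadratic G(y) is such a perturbation, and f has decay mu 0.

    The coefficients exist because the recursion only refers to smaller indices
    ([coeff_recursion_exists]), and they are power-like because power-like functions
    are closed under multilinear maps and under the derivatives in chi
    ([powerlike_coefs]). *)

Set Implicit Arguments.
Unset Strict Implicit.
Unset Printing Implicit Defensive.

Import Order.TTheory GRing.Theory Num.Theory.
Import numFieldNormedType.Exports.

Local Open Scope classical_set_scope.
Local Open Scope ring_scope.

(** * The decay scale *)

(** Constant factors and powers of iterated logarithms are both absorbed by e, so
    neither has to be tracked; this is why no constant appears in front of the
    power. *)
Definition decay (R : realType) (nu : R) (g : R -> R) : Prop :=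
  forall e : R, 0 < e -> \forall t \near +oo, `|g t| <= t `^ (e - nu).

Section Decay.
Variable R : realType.
Implicit Types (g h : R -> R) (a b c e nu : R).

Lemma near_pinfty_ge a : \forall t \near +oo, a <= t.
Proof. by apply: nbhs_pinfty_ge; exact: num_real. Qed.

Lemma near_pinfty_gt a : \forall t \near +oo, a < t.
Proof. by apply: nbhs_pinfty_gt; exact: num_real. Qed.

Lemma powRD_gt0 a b c : 0 < a -> a `^ (b + c) = a `^ b * a `^ c.
Proof. by move=> a0; rewrite powRD//; apply/implyP; rewrite (gt_eqF a0). Qed.

(** What lets an arbitrarily small positive power swallow any constant. *)
Lemma powR_ge_near c e : 0 < e -> \forall t \near +oo, c <= t `^ e.
Proof.
move=> e0; near=> t.
have c0 : c <= Num.max c 0 by rewrite le_max lexx.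
apply: (le_trans c0).
rewrite -[leLHS]powRr1 ?le_max ?lexx ?orbT// -(mulVf (lt0r_neq0 e0)) powRrM.
have t0 : 0 <= t by near: t; exact: near_pinfty_ge.
apply: ge0_ler_powR; rewrite ?nnegrE ?powR_ge0 ?(ltW e0)//.
Unshelve. all: by end_near. Qed.

Lemma decay_le nu nu' g : nu' <= nu -> decay nu g -> decay nu' g.
Proof.
move=> le_nu dg e e0; near=> t.
apply: (@le_trans _ _ (t `^ (e - nu))); first by near: t; exact: dg.
by apply: ler_powR; [near: t; exact: near_pinfty_ge|rewrite lerD2l lerN2].
Unshelve. all: by end_near. Qed.

Lemma decay_near nu g h : (\forall t \near +oo, `|h t| <= `|g t|) ->
  decay nu g -> decay nu h.
Proof.
move=> hg dg e e0; near=> t.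
apply: (@le_trans _ _ `|g t|); first by near: t.
by near: t; exact: dg.
Unshelve. all: by end_near. Qed.

Lemma decay_near_eq nu g h : (\forall t \near +oo, h t = g t) ->
  decay nu g -> decay nu h.
Proof.
move=> hg; apply: decay_near; near=> t.
by rewrite (_ : h t = g t)//; near: t.
Unshelve. all: by end_near. Qed.

Lemma decayN nu g : decay nu g -> decay nu (fun t => - g t).
Proof. by apply: decay_near; near=> t; rewrite normrN. Unshelve. all: by end_near. Qed.

(** Half of e pays for the factor 2. *)
Lemma decayD nu g h : decay nu g -> decay nu h -> decay nu (fun t => g t + h t).
Proof.
move=> dg dh e e0; have e20 : 0 < e / 2 by rewrite divr_gt0.
near=> t.
have t0 : 0 < t by near: t; exact: near_pinfty_gt.
apply: (le_trans (ler_normD _ _)).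
have -> : e - nu = e / 2 + (e / 2 - nu) by rewrite addrA -splitr.
rewrite powRD_gt0//.
apply: (@le_trans _ _ (2 * t `^ (e / 2 - nu))).
  rewrite mulr2n mulrDl mul1r; apply: lerD.
    by near: t; exact: dg.
  by near: t; exact: dh.
apply: ler_wpM2r; first exact: powR_ge0.
near: t; exact: powR_ge_near.
Unshelve. all: by end_near. Qed.

Lemma decayB nu g h : decay nu g -> decay nu h -> decay nu (fun t => g t - h t).
Proof. by move=> dg dh; apply: decayD => //; exact: decayN. Qed.

(** Each factor gets half of e. *)
Lemma decayM a b g h : decay a g -> decay b h ->
  decay (a + b) (fun t => g t * h t).
Proof.
move=> dg dh e e0; have e20 : 0 < e / 2 by rewrite divr_gt0.
near=> t.
have t0 : 0 < t by near: t; exact: near_pinfty_gt.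
have -> : e - (a + b) = (e / 2 - a) + (e / 2 - b).
  by rewrite addrACA -splitr opprD.
rewrite powRD_gt0// normrM; apply: ler_pM => //.
  by near: t; exact: dg.
by near: t; exact: dh.
Unshelve. all: by end_near. Qed.

Lemma decay_cst c : decay 0 (fun=> c).
Proof. by move=> e e0; rewrite subr0; exact: powR_ge_near. Qed.

Lemma decay0 nu : decay nu (fun=> 0).
Proof. by move=> e e0; near=> t; rewrite normr0 powR_ge0. Unshelve. all: by end_near. Qed.

Lemma decayZ c nu g : decay nu g -> decay nu (fun t => c * g t).
Proof. by rewrite -{2}(add0r nu) => dg; apply: decayM => //; exact: decay_cst. Qed.

Lemma decay_powR a : decay (- a) (fun t => t `^ a).
Proof.
move=> e e0; near=> t; rewrite ger0_norm ?powR_ge0// opprK.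
by apply: ler_powR; [near: t; exact: near_pinfty_ge|rewrite lerDr ltW].
Unshelve. all: by end_near. Qed.

Lemma decay_sum (I : Type) (r : seq I) (P : pred I) (F : I -> R -> R) nu :
  (forall i, P i -> decay nu (F i)) ->
  decay nu (fun t => \sum_(i <- r | P i) F i t).
Proof.
move=> dF; elim: r => [|i r IH].
  by apply: decay_near_eq (decay0 nu); near=> t; rewrite big_nil.
have [Pi|nPi] := boolP (P i).
  apply: decay_near_eq (decayD (dF i Pi) IH); near=> t.
  by rewrite big_cons Pi.
by apply: decay_near_eq IH; near=> t; rewrite big_cons (negbTE nPi).
Unshelve. all: by end_near. Qed.

Lemma decay_prod (I : Type) (r : seq I) (F : I -> R -> R) (nu : I -> R) :
  (forall i, decay (nu i) (F i)) ->
  decay (\sum_(i <- r) nu i) (fun t => \prod_(i <- r) F i t).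
Proof.
move=> dF; elim: r => [|i r IH].
  by rewrite big_nil; apply: decay_near_eq (decay_cst 1); near=> t; rewrite big_nil.
rewrite big_cons; apply: decay_near_eq (decayM (dF i) IH); near=> t.
by rewrite big_cons.
Unshelve. all: by end_near. Qed.

Lemma decay_of_bound nu nu' C g : nu <= nu' ->
  (\forall t \near +oo, `|g t| <= C * t `^ (- nu')) -> decay nu g.
Proof.
move=> le_nu bg; apply: (decay_le le_nu).
have dC := decayZ C (decay_powR (- nu')); rewrite opprK in dC.
apply: decay_near dC.
near=> t; apply: (@le_trans _ _ (C * t `^ (- nu'))); first by near: t.
exact: ler_norm.
Unshelve. all: by end_near. Qed.

End Decay.

(** * Iterated logarithms *)

Section IteratedLogs.
Variable R : realType.
Implicit Types (t c e : R).

Lemma iterlogS m t : iterlog m.+1 t = ln (iterlog m t).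
Proof. by []. Qed.

Lemma near_iterlog_ge m c : \forall t \near +oo, c <= iterlog m t.
Proof.
elim: m c => [|m IH] c; first exact: near_pinfty_ge.
near=> t; rewrite iterlogS -(expRK c) ler_ln ?posrE ?expR_gt0//.
  by near: t; exact: IH.
rewrite (lt_le_trans (expR_gt0 c))//.
by near: t; exact: IH.
Unshelve. all: by end_near. Qed.

Lemma near_iterlog_gt0 m : \forall t \near +oo, 0 < iterlog m t :> R.
Proof.
near=> t; rewrite (@lt_le_trans _ _ 1)//; near: t; exact: near_iterlog_ge.
Unshelve. all: by end_near. Qed.

Lemma near_iterlogs_gt0 m :
  \forall t \near +oo, forall j, (j <= m)%N -> 0 < iterlog j t :> R.
Proof.
have : \forall t \near +oo, forall j : 'I_m.+1, 0 < iterlog j t :> R.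
  by apply: filter_forall => j; exact: near_iterlog_gt0.
apply: filterS => t H j jm.
by have := H (Ordinal (jm : (j < m.+1)%N)).
Qed.

Lemma near_logvec_orthant m : \forall t \near +oo, orthant (logvec m t : 'rV[R]_m).
Proof.
have := near_iterlogs_gt0 m; apply: filterS => t H j.
by rewrite mxE; apply: H.
Qed.

(** The first logarithm is below every power of t because
    ln t = (2 / e) ln (t^(e/2)) <= (2 / e) t^(e/2); each further logarithm is
    smaller than the one it is applied to. *)
Lemma decay_iterlog m : decay (0 : R) (fun t => iterlog m.+1 t).
Proof.
elim: m => [|m IH].
  move=> e e0; have e20 : 0 < e / 2 by rewrite divr_gt0.
  near=> t.
  have t1 : 1 <= t by near: t; exact: near_pinfty_ge.
  have t0 : 0 < t by apply: lt_le_trans t1.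
  rewrite subr0 ger0_norm ?ln_ge0//=.
  have -> : ln t = (e / 2)^-1 * ln (t `^ (e / 2)).
    by rewrite ln_powR mulKf// gt_eqF.
  rewrite [in leRHS](splitr e) powRD_gt0//; apply: ler_pM.
  - by rewrite invr_ge0 ltW.
  - by rewrite ln_ge0// -[leLHS](powRr0 t) ler_powR// ltW.
  - by near: t; exact: powR_ge_near.
  - by apply/ltW/ln_sublinear; rewrite powR_gt0.
apply: decay_near IH; near=> t.
have l1 : 1 <= iterlog m.+1 t by near: t; exact: near_iterlog_ge.
have l0 : 0 < iterlog m.+1 t := lt_le_trans ltr01 l1.
rewrite iterlogS (ger0_norm (ln_ge0 l1)) (ger0_norm (ltW l0)).
by apply/ltW/ln_sublinear.
Unshelve. all: by end_near. Qed.

(** A positive power rescales e; a negative one is at most 1, since the iterated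
    logarithms eventually exceed 1. *)
Lemma decay_iterlog_powR m c : decay 0 (fun t => iterlog m.+1 t `^ c).
Proof.
move=> e e0; rewrite subr0.
have [c0|c0] := leP c 0; near=> t.
  have l1 : 1 <= iterlog m.+1 t by near: t; exact: near_iterlog_ge.
  rewrite ger0_norm ?powR_ge0// (@le_trans _ _ 1)//.
    by rewrite -[leRHS](powRr0 (iterlog m.+1 t)) ler_powR.
  by near: t; exact: powR_ge_near.
have l0 : 0 <= iterlog m.+1 t by near: t; exact: near_iterlog_ge.
rewrite ger0_norm ?powR_ge0// -(divfK (lt0r_neq0 c0) e) powRrM.
apply: ge0_ler_powR; rewrite ?nnegrE ?powR_ge0 ?(ltW c0)//.
rewrite -(ger0_norm l0) -(subr0 (e / c)); near: t.
by apply: decay_iterlog; rewrite divr_gt0.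
Unshelve. all: by end_near. Qed.

(** These are the factors t^-1 / (z_1 ... z_(j-1)) that the chain rule puts in
    front of the partial derivatives in chi. *)
Lemma is_derive_iterlog m t : (forall j, (j <= m)%N -> 0 < iterlog j t) ->
  is_derive t 1 (@iterlog R m.+1) (t * \prod_(i < m) iterlog i.+1 t)^-1.
Proof.
elim: m => [|m IH] l0.
  rewrite big_ord0 mulr1; apply: is_derive1_ln; exact: (l0 0%N).
rewrite big_ord_recr/= mulrA invfM mulrC.
apply: (@is_derive1_comp _ (@ln R) (iterlog m.+1)).
  by apply: is_derive1_ln; apply: l0.
by apply: IH => j jm; apply: l0; rewrite (leq_trans jm).
Qed.

End IteratedLogs.
(** * Power-like functions *)

(** The coordinates of a power-like function, with a list of monomials in place
    of a set: repeated exponents are allowed, so sums are concatenations and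
    products need no regrouping. *)
Definition scalar_powerlike (R : realType) (k : nat) (p : 'rV[R]_k -> R) :=
  exists s : seq ('rV[R]_k * R),
    forall z, orthant z -> p z = \sum_(x <- s) x.2 * monom z x.1.

Section ScalarPowerlike.
Variables (R : realType) (k : nat).
Implicit Types (p q : 'rV[R]_k -> R) (z a b : 'rV[R]_k) (c : R).

Lemma monom0 z : monom z 0 = 1.
Proof. by rewrite /monom big1// => j _; rewrite mxE powRr0. Qed.

Lemma monomD z a b : orthant z -> monom z (a + b) = monom z a * monom z b.
Proof.
move=> z0; rewrite /monom -big_split; apply: eq_bigr => j _ /=.
by rewrite mxE powRD_gt0.
Qed.

Lemma spl_eq p q : (forall z, orthant z -> p z = q z) ->
  scalar_powerlike p -> scalar_powerlike q.
Proof. by move=> pq [s sP]; exists s => z z0; rewrite -pq// sP. Qed.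

Lemma spl_term c a : scalar_powerlike (fun z => c * monom z a).
Proof. by exists [:: (a, c)] => z _; rewrite big_seq1. Qed.

Lemma spl_cst c : scalar_powerlike (fun _ : 'rV[R]_k => c).
Proof. by apply: spl_eq (spl_term c 0) => z _; rewrite monom0 mulr1. Qed.

Lemma splD p q : scalar_powerlike p -> scalar_powerlike q ->
  scalar_powerlike (fun z => p z + q z).
Proof.
by move=> [s sP] [s' sP']; exists (s ++ s') => z z0; rewrite big_cat/= sP ?sP'.
Qed.

Lemma spl_sum (I : Type) (r : seq I) (P : pred I) (F : I -> 'rV[R]_k -> R) :
  (forall i, P i -> scalar_powerlike (F i)) ->
  scalar_powerlike (fun z => \sum_(i <- r | P i) F i z).
Proof.
move=> FP; elim: r => [|i r IH].
  by apply: spl_eq (spl_cst 0) => z _; rewrite big_nil.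
have [Pi|nPi] := boolP (P i).
  by apply: spl_eq (splD (FP i Pi) IH) => z _; rewrite big_cons Pi.
by apply: spl_eq IH => z _; rewrite big_cons (negbTE nPi).
Qed.

Lemma splM p q : scalar_powerlike p -> scalar_powerlike q ->
  scalar_powerlike (fun z => p z * q z).
Proof.
move=> [s sP] [s' sP'].
have : scalar_powerlike (fun z => \sum_(x <- s) \sum_(x' <- s')
    (x.2 * x'.2) * monom z (x.1 + x'.1)).
  by apply: spl_sum => x _; apply: spl_sum => x' _; exact: spl_term.
apply: spl_eq => z z0; rewrite sP// sP'// big_distrl; apply: eq_bigr => x _ /=.
by rewrite big_distrr; apply: eq_bigr => x' _ /=; rewrite monomD// mulrACA.
Qed.

Lemma splZ c p : scalar_powerlike p -> scalar_powerlike (fun z => c * p z).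
Proof. by move=> pP; apply: splM => //; exact: spl_cst. Qed.

Lemma splN p : scalar_powerlike p -> scalar_powerlike (fun z => - p z).
Proof. by move=> pP; apply: spl_eq (splZ (-1) pP) => z _; rewrite mulN1r. Qed.

Lemma spl_prod (I : Type) (r : seq I) (P : pred I) (F : I -> 'rV[R]_k -> R) :
  (forall i, P i -> scalar_powerlike (F i)) ->
  scalar_powerlike (fun z => \prod_(i <- r | P i) F i z).
Proof.
move=> FP; elim: r => [|i r IH].
  by apply: spl_eq (spl_cst 1) => z _; rewrite big_nil.
have [Pi|nPi] := boolP (P i).
  by apply: spl_eq (splM (FP i Pi) IH) => z _; rewrite big_cons Pi.
by apply: spl_eq IH => z _; rewrite big_cons (negbTE nPi).
Qed.

Lemma spl_coord_powR (j : 'I_k) c : scalar_powerlike (fun z => z 0 j `^ c).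
Proof.
apply: spl_eq (spl_term 1 (c *: delta_mx 0 j)) => z z0; rewrite mul1r.
rewrite /monom (bigD1 j)//= big1 ?mulr1 => [|i ij].
  by rewrite !mxE !eqxx mulr1.
by rewrite !mxE (negbTE ij) andbF mulr0 powRr0.
Qed.

Lemma spl_coord_inv (j : 'I_k) : scalar_powerlike (fun z => (z 0 j)^-1).
Proof.
by apply: spl_eq (spl_coord_powR j (-1)) => z z0; rewrite powR_inv1// ltW.
Qed.

Lemma spl_decay p : scalar_powerlike p -> decay 0 (fun t => p (logvec k t)).
Proof.
move=> [s sP].
suff : decay 0 (fun t => \sum_(x <- s) x.2 * monom (logvec k t) x.1).
  apply: decay_near_eq; near=> t; rewrite sP//.
  by near: t; exact: near_logvec_orthant.
apply: decay_sum => x _; apply: decayZ.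
rewrite [X in decay X](_ : 0 = \sum_(j < k) (0 : R)); last by rewrite big1.
by apply: decay_prod => j; under eq_fun do rewrite mxE; exact: decay_iterlog_powR.
Unshelve. all: by end_near. Qed.

End ScalarPowerlike.

Section PowerlikeCoord.
Variables (R : realType) (k n : nat).
Implicit Types (p : 'rV[R]_k -> 'cV[R]_n).

Lemma powerlike_coord p :
  powerlike p <-> forall i, scalar_powerlike (fun z => p z i 0).
Proof.
split=> [[I [c [_ pP]]] i|pP].
  exists [seq (a, c a i 0) | a <- I] => z z0; rewrite pP// summxE big_map.
  by apply: eq_bigr => a _; rewrite mxE mulrC.
pose s i := sval (cid (pP i)).
have sP i z : orthant z -> p z i 0 = \sum_(x <- s i) x.2 * monom z x.1.
  by rewrite /s; case: cid => //= r; exact.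
(* The exponent 0 only serves to make the set nonempty. *)
pose I := (0 |` [fset x in flatten [seq [seq x.1 | x <- s i] | i <- enum 'I_n]])%fset.
exists I, (fun a => \col_i \sum_(x <- s i | x.1 == a) x.2); split.
  by apply/fset0Pn; exists 0; rewrite !inE eqxx.
move=> z z0; apply/colP => i; rewrite sP// summxE.
under [RHS]eq_bigr do rewrite !mxE big_mkcond/= big_distrr/=.
rewrite exchange_big/=; apply: eq_big_seq => x xs.
have xI : x.1 \in I.
  rewrite !inE; apply/orP; right; apply/flattenP.
  exists [seq x.1 | x <- s i]; last exact: map_f.
  by apply: map_f; rewrite mem_enum.
case: x {xs} xI => b c /= bI.
rewrite (bigD1_seq b bI (fset_uniq _)) ifT/=; last exact: eqxx.
rewrite mulrC big1 ?addr0// => a.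
by rewrite eq_sym => /negbTE ->; rewrite mulr0.
Qed.

End PowerlikeCoord.

Section LiftVars.
Variables (R : realType).

Lemma trunc_vars_logvec k m t : (k <= m)%N ->
  trunc_vars k (logvec m t) = logvec k t :> 'rV[R]_k.
Proof.
move=> km; apply/rowP => j; rewrite !mxE insubT/= ?(leq_trans (ltn_ord j))// => jm.
by rewrite mxE.
Qed.

Lemma trunc_vars_orthant k m (z : 'rV[R]_m) :
  orthant z -> orthant (trunc_vars k z).
Proof. by move=> z0 j; rewrite mxE; case: insubP => //= i _ _; exact: z0. Qed.

(** A truncated coordinate is either a coordinate of the longer vector or the
    constant 1, so monomials stay monomials. *)
Lemma spl_lift k m (p : 'rV[R]_k -> R) :
  scalar_powerlike p -> scalar_powerlike (lift_vars p : 'rV[R]_m -> R).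
Proof.
move=> [s sP].
have : scalar_powerlike (fun z : 'rV[R]_m =>
    \sum_(x <- s) x.2 * monom (trunc_vars k z) x.1).
  apply: spl_sum => x _; apply: splZ; apply: spl_prod => j _.
  case: (ltnP j m) => jm.
    apply: spl_eq (spl_coord_powR (Ordinal jm) (x.1 0 j)) => z _.
    by rewrite mxE insubT.
  apply: spl_eq (spl_cst _ 1) => z _.
  by rewrite mxE insubF ?powR1// ltnNge jm.
apply: spl_eq => z z0; rewrite /lift_vars sP//; exact: trunc_vars_orthant.
Qed.

Lemma powerlike_lift k m n (p : 'rV[R]_k -> 'cV[R]_n) :
  powerlike p -> powerlike (lift_vars p : 'rV[R]_m -> 'cV[R]_n).
Proof.
move=> /powerlike_coord pP; apply/powerlike_coord => i.
exact: (spl_lift _ (pP i)).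
Qed.

End LiftVars.

(** * Derivatives of power-like functions *)

Section Derivatives.
Variable R : realType.

Lemma is_derive_big_sum (I : Type) (r : seq I) (f : I -> R -> R) (df : I -> R)
    (t : R) : (forall i, is_derive t 1 (f i) (df i)) ->
  is_derive t 1 (fun s => \sum_(i <- r) f i s) (\sum_(i <- r) df i).
Proof.
move=> fdf; elim: r => [|i r IH].
  by under eq_fun do rewrite big_nil; rewrite big_nil; exact: is_derive_cst.
under eq_fun do rewrite big_cons; rewrite big_cons; exact: is_deriveD.
Qed.

(** Logarithmic differentiation: for monomials this yields a_j / z_j times the
    monomial itself, with no case distinction on the index j. *)
Lemma is_derive_big_prod (I : Type) (r : seq I) (f : I -> R -> R) (df : I -> R)
    (t : R) : (forall i, f i t != 0) -> (forall i, is_derive t 1 (f i) (df i)) ->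
  is_derive t 1 (fun s => \prod_(i <- r) f i s)
    (\prod_(i <- r) f i t * \sum_(i <- r) df i / f i t).
Proof.
move=> f0 fdf; elim: r => [|i r IH].
  under eq_fun do rewrite big_nil.
  by rewrite !big_nil mulr0; exact: is_derive_cst.
under eq_fun do rewrite big_cons; rewrite !big_cons.
apply: (is_derive_eq (is_deriveM (fdf i) IH)).
rewrite /GRing.scale/=; move: (f0 i) => fi0; field; exact: fi0.
Qed.

Lemma is_deriveZr (f : R -> R) (df c t : R) : is_derive t 1 f df ->
  is_derive t 1 (fun s => c * f s) (c * df).
Proof. exact: (@is_deriveZ _ _ _ f c). Qed.

Lemma is_derive_mul (f g : R -> R) (df dg t : R) :
  is_derive t 1 f df -> is_derive t 1 g dg ->
  is_derive t 1 (fun s => f s * g s) (f t * dg + g t * df).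
Proof. exact: is_deriveM. Qed.

(** The chain rule along arbitrary curves serves twice: on a coordinate line it
    computes the partial derivatives, on the curve of iterated logarithms it
    differentiates the terms of the expansion. *)
Lemma spl_chain k (p : 'rV[R]_k -> R) : scalar_powerlike p ->
  exists dp : 'I_k -> 'rV[R]_k -> R, (forall j, scalar_powerlike (dp j)) /\
    forall (g : R -> 'rV[R]_k) (dg : 'I_k -> R) t, orthant (g t) ->
      (forall j, is_derive t 1 (fun s => g s 0 j) (dg j)) ->
      is_derive t 1 (fun s => p (g s)) (\sum_j dg j * dp j (g t)).
Proof.
move=> [s sP].
exists (fun j z => \sum_(x <- s) (x.2 * x.1 0 j) * (monom z x.1 * (z 0 j)^-1)); split.
  move=> j /=; apply: spl_sum => x _; apply: splZ; apply: splM.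
    by apply: spl_eq (spl_term 1 x.1) => z _; rewrite mul1r.
  exact: spl_coord_inv.
move=> g dg t gt0 gdg.
have near_orthant : \forall u \near t, orthant (g u).
  suff : \forall u \near t, forall j, 0 < g u 0 j by [].
  apply: (@filter_forall _ _ (fun j u => 0 < g u 0 j) (nbhs t)) => j.
  have : {for t, continuous (fun s => g s 0 j)}.
    by apply/differentiable_continuous/derivable1_diffP; have [] := gdg j.
  by move/(_ _ (lt_nbhsr (gt0 j))).
apply: (@near_eq_is_derive _ _ _ (fun u => \sum_(x <- s) x.2 * monom (g u) x.1)).
  by near=> u; rewrite sP//; near: u.
have dmon (x : 'rV[R]_k * R) : is_derive t 1 (fun u => monom (g u) x.1)
    (monom (g t) x.1 * \sum_j x.1 0 j * ((g t 0 j)^-1 * dg j)).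
  apply: (is_derive_eq (is_derive_big_prod _ (f := fun j u => g u 0 j `^ x.1 0 j)
    (df := fun j => (x.1 0 j * g t 0 j `^ (x.1 0 j - 1)) * dg j) _ _)).
  - by move=> j; rewrite gt_eqF// powR_gt0.
  - move=> j; apply: (@is_derive1_comp _ (fun w => w `^ x.1 0 j) (fun u => g u 0 j)).
    exact: is_derive1_powR.
  congr (_ * _); apply: eq_bigr => j _.
  have P0 : g t 0 j `^ x.1 0 j != 0 by rewrite gt_eqF// powR_gt0.
  have g0 : g t 0 j != 0 by rewrite gt_eqF.
  by rewrite powRD_gt0// powR_inv1 ?(ltW (gt0 j))//; field; rewrite P0 g0.
apply: (is_derive_eq (is_derive_big_sum s (fun x => is_deriveZr x.2 (dmon x)))).
under [RHS]eq_bigr do rewrite big_distrr/=.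
rewrite exchange_big; apply: eq_bigr => x _ /=.
rewrite mulrA big_distrr; apply: eq_bigr => j _ /=.
by ring.
Unshelve. all: by end_near. Qed.

Lemma derive_lineE (V W : normedModType R) (f : V -> W) (x v : V) :
  'D_v f x = 'D_1 (fun h : R => f (h *: v + x)) 0.
Proof.
rewrite /derive; set g1 := fun h => h^-1 *: _; set g2 := fun h => h^-1 *: _.
suff -> : g1 = g2 by []; apply/funext => h; rewrite /g1 /g2 /=.
by rewrite addr0 scale0r add0r [_%:A]mulr1.
Qed.

Lemma powerlike_chain k n (p : 'rV[R]_k -> 'cV[R]_n) : powerlike p ->
  (forall j, powerlike ('D_(delta_mx 0 j) p)) /\
  forall (g : R -> 'rV[R]_k) (dg : 'I_k -> R) t, orthant (g t) ->
    (forall j, is_derive t 1 (fun s => g s 0 j) (dg j)) ->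
    forall i, is_derive t 1 (fun s => p (g s) i 0)
      (\sum_j dg j * 'D_(delta_mx 0 j) p (g t) i 0).
Proof.
move=> /powerlike_coord pP.
pose dp i := sval (cid (spl_chain (pP i))).
have dpl i j : scalar_powerlike (dp i j).
  by rewrite /dp; case: cid => /= d [].
have dpP i (g : R -> 'rV[R]_k) (dg : 'I_k -> R) t : orthant (g t) ->
      (forall j, is_derive t 1 (fun s => g s 0 j) (dg j)) ->
      is_derive t 1 (fun s => p (g s) i 0) (\sum_j dg j * dp i j (g t)).
  by rewrite /dp; case: cid => /= d [_]; exact.
have dpE i j z : orthant z -> 'D_(delta_mx 0 j) p z i 0 = dp i j z.
  move=> z0.
  have line i' : is_derive (0 : R) 1
      (fun h : R => p (h *: delta_mx 0 j + z) i' 0) (dp i' j z).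
    apply: (is_derive_eq (dpP i' (fun h => h *: delta_mx 0 j + z)
      (fun l => (l == j)%:R) 0 _ _)).
    - by rewrite scale0r add0r.
    - move=> l.
      have -> : (fun h : R => (h *: delta_mx 0 j + z) 0 l) =
          (fun h => (l == j)%:R * h + z 0 l).
        by apply/funext => h; rewrite !mxE eqxx/= mulrC.
      apply: (is_derive_eq (is_deriveD
        (is_deriveZr _ (is_derive_id _ _)) (is_derive_cst _ _ _))).
      by rewrite addr0 mulr1.
    rewrite scale0r add0r (bigD1 j)//= eqxx mul1r big1 ?addr0// => l /negbTE ->.
    by rewrite mul0r.
  have der : derivable p z (delta_mx 0 j).
    apply/derivable1P; apply/derivable_mxP => i' j'.
    by rewrite ord1; have [] := line i'.
  rewrite derive_mx// mxE derive_lineE.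
  by have [_] := line i.
split=> [j|g dg t gt0 gdg i].
  by apply/powerlike_coord => i; apply: spl_eq (dpl i j) => z z0; rewrite dpE.
apply: (is_derive_eq (dpP i g dg t gt0 gdg)).
by apply: eq_bigr => j _; rewrite dpE.
Qed.

Lemma derive_lift_vars0 k m (X : normedModType R) (p : 'rV[R]_k -> X) (j : 'I_m)
    (z : 'rV[R]_m) : (k <= j)%N -> 'D_(delta_mx 0 j) (lift_vars p) z = 0.
Proof.
move=> kj; rewrite derive_lineE.
rewrite (_ : (fun h : R => _) = cst (lift_vars p z)); first exact: derive_cst.
apply/funext => h /=; rewrite /lift_vars; congr p; apply/rowP => i.
rewrite !mxE; case: insubP => //= u _ ui; rewrite !mxE eqxx/=.
suff /negbTE -> : u != j by rewrite mulr0 add0r.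
by apply: contraTneq kj => uj; rewrite -ltnNge -uj ui.
Qed.

End Derivatives.
(** * Multilinear maps *)

Section Multilinear.
Variables (R : realType) (n : nat).
Local Notation V := 'cV[R]_n.

Definition fcons (m : nat) (x : V) (w : 'I_m -> V) : 'I_m.+1 -> V :=
  fun i => oapp w x (unlift ord0 i).

Lemma dfwith_fcons0 m (x x' : V) (w : 'I_m -> V) :
  dfwith (fcons x w) ord0 x' = fcons x' w.
Proof.
apply/funext => i; rewrite /fcons.
case: (unliftP ord0 i) => [j ->|->] /=; last by rewrite dfwithin.
by rewrite dfwithout// liftK.
Qed.

Lemma dfwith_fconsS m (x x' : V) (w : 'I_m -> V) (i : 'I_m) :
  dfwith (fcons x w) (lift ord0 i) x' = fcons x (dfwith w i x').
Proof.
apply/funext => j; rewrite /fcons.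
case: (unliftP ord0 j) => [j' ->|->] /=; last first.
  by rewrite dfwithout ?unlift_none// eq_sym.
have [->|ij] := eqVneq i j'; first by rewrite !dfwithin.
by rewrite !dfwithout ?liftK// (inj_eq lift_inj).
Qed.

Lemma linear_delta (f : V -> V) : linear f ->
  forall x, f x = \sum_k x k 0 *: f (delta_mx k 0).
Proof.
move=> lf x; pose L : {linear V -> V} := HB.pack f (GRing.isLinear.Build _ _ _ _ f lf).
rewrite -[f]/(L : V -> V) {1}(matrix_sum_delta x) linear_sum.
by apply: eq_bigr => k _; rewrite big_ord1 linearZ.
Qed.

(** Multilinear maps reduced to finite sums of products of coordinates. The index
    set and the choice of coordinates depend only on m, which makes the induction
    on the number of arguments go through: fixing the first argument to each basis
    vector gives maps that share the same indexing. *)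
Lemma multilinear_repr m : exists (I : finType) (kk : I -> 'I_m -> 'I_n),
  forall F : ('I_m -> V) -> V, multilinear_map F ->
  exists c : I -> V, forall v, F v = \sum_x (\prod_l v l (kk x l) 0) *: c x.
Proof.
elim: m => [|m [I [kk IH]]].
  have kk0 : unit -> 'I_0 -> 'I_n by move=> _ [].
  exists unit, kk0 => F _; exists (fun=> F (fun=> 0)) => v.
  (* No argument at all: the map is a constant. *)
  rewrite (big_pred1 tt) => [|[]//]; rewrite big_ord0 scale1r; congr F.
  by apply/funext => -[].
exists ('I_n * I)%type, (fun kx i => oapp (kk kx.2) kx.1 (unlift ord0 i)) => F FL.
have FkL k : multilinear_map (fun w => F (fcons (delta_mx k 0) w)).
  move=> w i a x x'; rewrite -!dfwith_fconsS; exact: FL.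
pose c k := sval (cid (IH _ (FkL k))).
have cP k w : F (fcons (delta_mx k 0) w) =
    \sum_x (\prod_l w l (kk x l) 0) *: c k x.
  by rewrite /c; case: cid.
exists (fun kx => c kx.1 kx.2) => v.
have -> : v = fcons (v ord0) (fun i => v (lift ord0 i)).
  apply/funext => i; rewrite /fcons.
  by case: (unliftP ord0 i) => [j ->|->].
set w := fun i => _.
transitivity (\sum_k v ord0 k 0 *: F (fcons (delta_mx k 0) w)).
  have lin : linear (fun x => F (fcons x w)).
    by move=> a x x'; have := FL (fcons 0 w) ord0 a x x'; rewrite !dfwith_fcons0.
  exact: (linear_delta lin).
under eq_bigr do rewrite cP scaler_sumr.
rewrite pair_bigA /=; apply: eq_bigr => -[k x] _ /=.
rewrite scalerA big_ord_recl /fcons unlift_none/=; congr (_ * _ *: _).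
by apply: eq_bigr => l _; rewrite liftK.
Qed.

Lemma multilinear_expand m (F : ('I_m -> V) -> V) N (v : 'I_N -> V) :
  multilinear_map F ->
  F (fun=> \sum_k v k) = \sum_(j : {ffun 'I_m -> 'I_N}) F (fun i => v (j i)).
Proof.
have [I [kk H]] := multilinear_repr m => /H [c cP].
rewrite cP; under [RHS]eq_bigr do rewrite cP.
rewrite exchange_big/=; apply: eq_bigr => x _; rewrite -scaler_suml; congr (_ *: _).
under eq_bigr do rewrite summxE.
exact: bigA_distr_bigA.
Qed.

Lemma multilinear_scale m (F : ('I_m -> V) -> V) (a : 'I_m -> R) (v : 'I_m -> V) :
  multilinear_map F -> F (fun i => a i *: v i) = (\prod_i a i) *: F v.
Proof.
have [I [kk H]] := multilinear_repr m => /H [c cP].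
rewrite !cP scaler_sumr; apply: eq_bigr => x _; rewrite scalerA; congr (_ *: _).
by rewrite -big_split; apply: eq_bigr => l _; rewrite mxE.
Qed.

Lemma multilinear_powerlike k m (F : ('I_m -> V) -> V) (p : 'I_m -> 'rV[R]_k -> V) :
  multilinear_map F -> (forall l, powerlike (p l)) ->
  powerlike (fun z => F (fun l => p l z)).
Proof.
have [I [kk H]] := multilinear_repr m => /H [c cP] pP.
apply/powerlike_coord => i.
apply: (@spl_eq _ _ (fun z => \sum_x (\prod_l p l z (kk x l) 0) * c x i 0)).
  by move=> z _; rewrite cP summxE; apply: eq_bigr => x _; rewrite mxE.
apply: spl_sum => x _; apply: splM; last exact: spl_cst.
by apply: spl_prod => l _; move: (pP l) => /powerlike_coord; apply.
Qed.

(** Telescoping: in a difference of products one factor is a difference, of decay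
    b, and at least one other factor contributes decay a. *)
Lemma decay_prod_sub (I : Type) (r : seq I) (g h : I -> R -> R) (a b : R) :
  0 <= a -> (forall i, decay a (g i)) -> (forall i, decay a (h i)) ->
  (forall i, decay b (fun t => g i t - h i t)) ->
  (2 <= size r)%N ->
  decay (a + b) (fun t => \prod_(i <- r) g i t - \prod_(i <- r) h i t).
Proof.
move=> a0 ga ha gh.
have prod0 s (u : I -> R -> R) : (forall i, decay a (u i)) ->
    decay 0 (fun t => \prod_(i <- s) u i t).
  move=> ua; rewrite [X in decay X](_ : 0 = \sum_(i <- s) (0 : R)); last by rewrite big1.
  by apply: decay_prod => i; apply: decay_le (ua i).
have prod_a i s (u : I -> R -> R) : (forall i, decay a (u i)) ->
    decay a (fun t => \prod_(i <- i :: s) u i t).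
  move=> ua; rewrite -(addr0 a).
  apply: decay_near_eq (decayM (ua i) (prod0 s u ua)).
  by near=> t; rewrite big_cons.
(* Peeling off one factor: g_i G - h_i H = (g_i - h_i) G + h_i (G - H). *)
have step c i s : decay c (fun t => \prod_(i <- s) g i t) ->
    decay (b + c - a) (fun t => \prod_(i <- s) g i t - \prod_(i <- s) h i t) ->
    decay (b + c) (fun t => \prod_(i <- i :: s) g i t - \prod_(i <- i :: s) h i t).
  move=> gc ghc.
  have D1 := decayM (gh i) gc.
  have D2 := decayM (ha i) ghc; rewrite addrC subrK in D2.
  apply: decay_near_eq (decayD D1 D2); near=> t.
  by rewrite !big_cons; ring.
have diff_b s : decay b (fun t => \prod_(i <- s) g i t - \prod_(i <- s) h i t).
  elim: s => [|i s IH].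
    apply: decay_near_eq (decay0 b); near=> t.
    by rewrite !big_nil subrr.
  rewrite -(addr0 b); apply: step; first exact: prod0.
  by apply: decay_le IH; rewrite addr0 gerBl.
case: r => [//|i [//|i' r]] _.
rewrite addrC; apply: step; first exact: prod_a.
by rewrite addrK.
Unshelve. all: by end_near. Qed.

Lemma decay_multilinear m (F : ('I_m -> V) -> V) (u : 'I_m -> R -> V) (a : 'I_m -> R) :
  multilinear_map F -> (forall l i, decay (a l) (fun t => u l t i 0)) ->
  forall i, decay (\sum_l a l) (fun t => F (fun l => u l t) i 0).
Proof.
have [I [kk H]] := multilinear_repr m => /H [c cP] ua i.
apply: (@decay_near_eq _ _ (fun t => \sum_x c x i 0 * \prod_l u l t (kk x l) 0)).
  near=> t; rewrite cP summxE; apply: eq_bigr => x _.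
  by rewrite mxE mulrC.
apply: decay_sum => x _; apply: decayZ.
exact: (decay_prod _ (F := fun l t => u l t (kk x l) 0)).
Unshelve. all: by end_near. Qed.

(** The source of the gain at each step of the main induction: a term of degree at
    least 2 turns an error of decay b into one of decay a + b. *)
Lemma decay_multilinear_sub m (F : ('I_m -> V) -> V) (u v : R -> V) (a b : R) :
  (2 <= m)%N -> multilinear_map F -> 0 <= a ->
  (forall i, decay a (fun t => u t i 0)) -> (forall i, decay a (fun t => v t i 0)) ->
  (forall i, decay b (fun t => (u t - v t) i 0)) ->
  forall i, decay (a + b) (fun t => (F (fun=> u t) - F (fun=> v t)) i 0).
Proof.
have [I [kk H]] := multilinear_repr m => m2 /H [c cP] a0 ua va uv i.
apply: (@decay_near_eq _ _ (fun t => \sum_x c x i 0 *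
    (\prod_l u t (kk x l) 0 - \prod_l v t (kk x l) 0))).
  near=> t; rewrite !cP -sumrB summxE; apply: eq_bigr => x _.
  by rewrite !mxE -mulrBl mulrC.
apply: decay_sum => x _; apply: decayZ.
apply: (decay_prod_sub (g := fun l t => u t (kk x l) 0)
  (h := fun l t => v t (kk x l) 0)) => // [l|].
  by apply: decay_near_eq (uv (kk x l)); near=> t; rewrite !mxE.
by rewrite -sum1_size big_const_ord iter_addn_0 mul1n.
Unshelve. all: by end_near. Qed.

End Multilinear.

(** * The exponents *)

Section Exponents.
Variables (R : realType) (mu : nat -> R).
Hypothesis mu_seq : divergent_positive_increasing mu.

Lemma mu_gt0 k : 0 < mu k. Proof. by case: mu_seq. Qed.

Lemma mu_lt i j : (i < j)%N -> mu i < mu j.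
Proof. by case: mu_seq => _ + _; exact. Qed.

Lemma mu_le i j : (i <= j)%N -> mu i <= mu j.
Proof. by rewrite leq_eqVlt => /predU1P[->//|/mu_lt /ltW]. Qed.

Lemma mu_ltE i j : (mu i < mu j) = (i < j)%N.
Proof.
by case: ltnP => ij; [exact: mu_lt|apply/negbTE; rewrite -leNgt mu_le].
Qed.

Lemma mu_inj : injective mu.
Proof.
by move=> i j ij; case: (ltngtP i j) => [/mu_lt|/mu_lt|//]; rewrite ij ltxx.
Qed.

(** Only finitely many degrees m matter below a given exponent. *)
Lemma mu_natmul_ub x : exists2 M : nat, (2 <= M)%N & x <= mu 0%N *+ M.
Proof.
exists (maxn 2 (Num.truncn (x / mu 0%N)).+1); first by rewrite leq_maxl.
apply: (@le_trans _ _ (mu 0%N *+ (Num.truncn (x / mu 0%N)).+1)).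
  by rewrite -mulr_natl -ler_pdivrMr ?mu_gt0// ltW// truncnS_gt.
by rewrite ler_wpMn2l ?(ltW (mu_gt0 _))// leq_maxr.
Qed.

Lemma sum_mu_ge m (j : 'I_m -> nat) : mu 0%N *+ m <= \sum_i mu (j i).
Proof.
by rewrite -[in leLHS](card_ord m) -sumr_const; apply: ler_sum => i _; exact: mu_le.
Qed.

(** With at least two positive summands, each is smaller than the sum; hence the
    recursion for q k refers only to earlier coefficients. *)
Lemma sum_mu_index_lt m (j : 'I_m -> nat) k : (2 <= m)%N ->
  \sum_i mu (j i) = mu k -> forall i, (j i < k)%N.
Proof.
move=> m2 jk i; rewrite -mu_ltE -jk (bigD1 i)//= ltrDl.
have [i' i'i] : exists i' : 'I_m, i' != i.
  case: m j jk m2 i => [|[|m]] j _ // _ i.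
  have [->|] := eqVneq i ord0; first by exists ord_max.
  by exists ord0; rewrite eq_sym.
rewrite (bigD1 i')//=; apply: ltr_wpDr; last exact: mu_gt0.
by apply: sumr_ge0 => ? _; exact/ltW/mu_gt0.
Qed.

(** The sums of the recursion range over all degrees and all natural indices; they
    become sums over fixed finite ranges. Allowing any bound B >= k permits the
    same range for all coefficients up to a given order. *)
Lemma nonlin_sum_finite (X : lmodType R) (H : forall m, {ffun 'I_m -> nat} -> X)
    (k B M : nat) : (k <= B)%N -> mu k < mu 0%N *+ M.+1 ->
  \sum_(m \in [set m : nat | (2 <= m)%N])
    \sum_(j \in [set j : {ffun 'I_m -> nat} | \sum_(i < m) mu (j i) = mu k]) H m j
  = \sum_(2 <= m < M.+1) \sum_(j : {ffun 'I_m -> 'I_B} | \sum_i mu (j i) == mu k)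
      H m [ffun i => val (j i)].
Proof.
move=> kB kM.
rewrite -(fsbig_widen [set` index_iota 2 M.+1]); first last.
- move=> m [/= m2 /negP]; rewrite mem_index_iota m2/= -leqNgt => Mm.
  rewrite (_ : [set j | _] = set0) ?fsbig_set0//; apply/seteqP; split=> // j /= jk.
  have := sum_mu_ge j; rewrite jk; apply/negP; rewrite -ltNge.
  by apply: (lt_le_trans kM); rewrite ler_wpMn2l// ltW// mu_gt0.
- by move=> m /=; rewrite mem_index_iota => /andP[].
rewrite -fsbig_seq ?iota_uniq//; apply: eq_big_seq => m.
rewrite mem_index_iota => /andP[m2 _].
pose h (j : {ffun 'I_m -> 'I_B}) : {ffun 'I_m -> nat} := [ffun i => val (j i)].
have h_inj : injective h.
  move=> j j' /ffunP jj'; apply/ffunP => i; apply: val_inj.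
  by have := jj' i; rewrite !ffunE.
pose r := seq.filter (fun j : {ffun 'I_m -> 'I_B} => \sum_i mu (j i) == mu k)
  (enum {ffun 'I_m -> 'I_B}).
have r_uniq : uniq r by rewrite filter_uniq ?enum_uniq.
transitivity (\sum_(j <- r) H m (h j)); last by rewrite big_filter big_enum_cond.
transitivity (\sum_(j \in h @` [set` r]) H m j); last first.
  have h_inj_r : set_inj [set` r] h by move=> ? ? _ _ /h_inj.
  by rewrite (fsbig_image [set` r] h (H m) h_inj_r) -fsbig_seq.
apply: eq_fsbigl; apply/seteqP; split=> [j /= jk|_ [j /= + <-]].
  have jB i : (j i < B)%N := leq_trans (sum_mu_index_lt m2 jk i) kB.
  exists [ffun i => Ordinal (jB i)] => /=.
    rewrite mem_filter mem_enum andbT -jk; apply/eqP.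
    by apply: eq_bigr => i _; rewrite ffunE.
  by apply/ffunP => i; rewrite !ffunE.
rewrite mem_filter => /andP[/eqP <- _].
by apply: eq_bigr => i _; rewrite ffunE.
Qed.

End Exponents.
(** * Decay of damped linear systems *)

Section Energy.
Variable R : realType.

(** With c = a / 2, the function e^(c t) (t^b w - C / c) is eventually
    nonincreasing: half of the damping a pays for the derivative of t^b, the other
    half for that of e^(c t). *)
Lemma damped_comparison (w dw : R -> R) (a b C : R) : 0 < a ->
  (\forall t \near +oo, 0 <= w t) ->
  (\forall t \near +oo, is_derive (t : R) 1 w (dw t)) ->
  (\forall t \near +oo, dw t <= - a * w t + C * t `^ (- b)) ->
  exists K, \forall t \near +oo, w t <= K * t `^ (- b).
Proof.
move=> a0 w0 wdw dw_le.
pose c := a / 2; have c0 : 0 < c by rewrite divr_gt0.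
pose phi t := expR (c * t) * (t `^ b * w t - C / c).
have [T0 [T0real H]] : \forall t \near +oo, [/\ 0 < t, `|b| / t <= c, 0 <= w t,
    is_derive (t : R) 1 w (dw t) & dw t <= - a * w t + C * t `^ (- b)].
  near=> t; have t0 : 0 < t by [].
  split=> //; [|by near: t..].
  by rewrite ler_pdivrMr// mulrC -ler_pdivrMr.
pose T := T0 + 1; have T0T : T0 < T by rewrite ltrDl.
have H' t : T <= t -> [/\ 0 < t, `|b| / t <= c, 0 <= w t,
    is_derive (t : R) 1 w (dw t) & dw t <= - a * w t + C * t `^ (- b)].
  by move=> Tt; apply: H; exact: lt_le_trans Tt.
pose dphi t := expR (c * t) *
  (c * (t `^ b * w t - C / c) + (b * t `^ (b - 1) * w t + t `^ b * dw t)).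
have phi_der t : T <= t -> is_derive (t : R) 1 phi (dphi t).
  move=> /H'[t0 _ _ wt _].
  have D1 : is_derive (t : R) 1 (fun s => expR (c * s)) (expR (c * t) * (c * 1)).
    exact: (@is_derive1_comp _ (@expR R) (fun s => c * s)).
  have D2 : is_derive (t : R) 1 (fun s => s `^ b * w s - C / c)
      (t `^ b *: dw t + w t *: (b * t `^ (b - 1)) - 0).
    exact: (is_deriveB (is_deriveM (is_derive1_powR b t0) wt) (is_derive_cst _ _ _)).
  apply: (is_derive_eq (is_deriveM D1 D2)).
  by rewrite /dphi /GRing.scale/=; ring.
have dphi_le t : T <= t -> dphi t <= 0.
  move=> /H'[t0 bt wt _ dwt]; rewrite /dphi pmulr_rle0 ?expR_gt0//.
  have P0 : 0 < t `^ b by rewrite powR_gt0.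
  have e1 : t `^ (b - 1) = t `^ b * t^-1 by rewrite powRD_gt0// powR_inv1// ltW.
  have e2 : b * t `^ (b - 1) * w t <= c * (t `^ b * w t).
    rewrite e1 (_ : b * _ * _ = (b / t) * (t `^ b * w t)); last by ring.
    apply: ler_wpM2r; first by rewrite mulr_ge0// ltW.
    by apply: le_trans bt; rewrite ler_wpM2r ?ler_norm// invr_ge0 ltW.
  have e3 : t `^ b * dw t <= - a * (t `^ b * w t) + C.
    apply: (@le_trans _ _ (t `^ b * (- a * w t + C * t `^ (- b)))).
      by rewrite ler_wpM2l// ltW.
    by rewrite mulrDr mulrCA [X in _ + X]mulrCA -powRD_gt0// subrr powRr0 mulr1.
  have e4 : c * (t `^ b * w t - C / c) = c * (t `^ b * w t) - C.
    by field; rewrite gt_eqF.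
  have e5 : c * (t `^ b * w t) + c * (t `^ b * w t) = a * (t `^ b * w t).
    by rewrite -mulrDl -splitr.
  rewrite e4; lra.
have phi_dec t : T <= t -> phi t <= phi T.
  move=> Tt; apply: (@ler0_derive1_nincry R phi T _ _ _ T t (lexx T) Tt).
  - by move=> x; rewrite in_itv/= andbT => /ltW/phi_der[].
  - move=> x; rewrite in_itv/= andbT => /ltW Tx.
    by rewrite derive1E; have [_ ->] := phi_der x Tx; exact: dphi_le.
  - apply: derivable_within_continuous => x; rewrite in_itv/= andbT => Tx.
    by have [] := phi_der x Tx.
exists (C / c + `|phi T|); near=> t.
have Tt : T <= t by [].
have [t0 _ _ _ _] := H' t Tt.
rewrite powRN ler_pdivlMr ?powR_gt0// mulrC -lerBlDl.
have ect : 1 <= expR (c * t) by rewrite -expR0 ler_expR mulr_ge0// ltW.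
have := phi_dec t Tt; rewrite {1}/phi => phit.
have [neg|pos] := leP (t `^ b * w t - C / c) 0; first by apply: (le_trans neg).
apply: (@le_trans _ _ (phi T)); last exact: ler_norm.
by apply: le_trans phit; rewrite ler_peMl// ltW.
Unshelve. all: by end_near. Qed.

Definition norm1 (n : nat) (x : 'cV[R]_n) : R := \sum_j `|x j 0|.

Definition mxnorm1 (n : nat) (S : 'M[R]_n) : R := \sum_i \sum_j `|S i j|.

Lemma norm1_ge0 n (x : 'cV[R]_n) : 0 <= norm1 x.
Proof. by apply: sumr_ge0. Qed.

Lemma coord_le_norm1 n (x : 'cV[R]_n) j : `|x j 0| <= norm1 x.
Proof. by rewrite /norm1 (bigD1 j)//= lerDl sumr_ge0. Qed.

Lemma mxnorm1_ge0 n (S : 'M[R]_n) : 0 <= mxnorm1 S.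
Proof. by apply: sumr_ge0 => i _; apply: sumr_ge0. Qed.

Lemma norm1_mulmx n (S : 'M[R]_n) (x : 'cV[R]_n) (B : R) :
  (forall j, `|x j 0| <= B) -> norm1 (S *m x) <= mxnorm1 S * B.
Proof.
move=> xB; rewrite /norm1 /mxnorm1 mulr_suml; apply: ler_sum => i _.
rewrite mxE (le_trans (ler_norm_sum _ _ _))// mulr_suml; apply: ler_sum => j _.
by rewrite normrM ler_wpM2l.
Qed.

Lemma coord_le_sqrt_sum n (x : 'cV[R]_n) j :
  `|x j 0| <= Num.sqrt (\sum_i x i 0 ^+ 2).
Proof.
rewrite -sqrtr_sqr ler_wsqrtr// (bigD1 j)//= lerDl.
by apply: sumr_ge0 => i _; exact: sqr_ge0.
Qed.

(** Energy estimate. In the coordinates x = S u the system is diagonal, and the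
    energy w = sum of x_i^2 satisfies w' <= - al w + |h|^2 / al, where h is the
    transformed right-hand side and al a lower bound for the eigenvalues. The part
    of h of size eta |u| costs at most half of the damping when eta is small. *)
Lemma damped_system n (A : 'M[R]_n) : diagonalizable_pos A ->
  exists2 eta, 0 < eta & forall (u du : R -> 'cV[R]_n) (nu C : R),
    (\forall t \near +oo, forall i, is_derive (t : R) 1 (fun s => u s i 0) (du t i 0)) ->
    (\forall t \near +oo, forall i, `|(du t + A *m u t) i 0|
        <= eta * norm1 (u t) + C * t `^ (- nu)) ->
    exists K, \forall t \near +oo, forall i, `|u t i 0| <= K * t `^ (- nu).
Proof.
move=> [S [a [Su a0 AE]]].
have [al al0 ala] : exists2 al, 0 < al & forall i, al <= a 0 i.
  exists (\big[Num.min/1]_i a 0 i).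
    by elim/big_ind : _ => // x y x0 y0; rewrite lt_min x0.
  by move=> i; exact: bigmin_le_cond.
pose k1 := mxnorm1 S; pose k2 := mxnorm1 (invmx S).
have k10 : 0 <= k1 by exact: mxnorm1_ge0.
have k20 : 0 <= k2 by exact: mxnorm1_ge0.
pose Q := n%:R * (2 * (k1 * k2) ^+ 2) / al.
have Q0 : 0 <= Q by rewrite /Q divr_ge0 ?mulr_ge0 ?sqr_ge0// ltW.
(* Chosen so that Q eta^2 <= al / 2; Q collects the constants in front of w in the
   bound for the sum of h_i^2 / al. *)
pose eta := Num.sqrt (al / (2 * (Q + 1))).
have Q1 : 0 < Q + 1 by rewrite ltr_wpDl.
have eta0 : 0 < eta by rewrite sqrtr_gt0 divr_gt0// mulr_gt0.
have Qeta : Q * eta ^+ 2 <= al / 2.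
  rewrite sqr_sqrtr; last by rewrite divr_ge0// ?(ltW al0)// mulr_ge0// ltW.
  rewrite (_ : Q * _ = (al / 2) * (Q / (Q + 1))); last by field; rewrite gt_eqF.
  by rewrite ler_piMr ?divr_ge0 ?(ltW al0)// ler_pdivrMr// mul1r lerDl.
exists eta => // u du nu C u_der u_le.
pose x t := S *m u t.
pose h t := S *m (du t + A *m u t).
pose w t := \sum_i x t i 0 ^+ 2.
pose dw t := \sum_i 2 * x t i 0 * (h t i 0 - a 0 i * x t i 0).
have uE t : u t = invmx S *m x t by rewrite /x mulKmx.
have w0 t : 0 <= w t by apply: sumr_ge0 => i _; exact: sqr_ge0.
have dxE t i : (S *m du t) i 0 = h t i 0 - a 0 i * x t i 0.
  have -> : S *m du t = h t - diag_mx a *m x t.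
    by rewrite /h /x mulmxDr AE !mulmxA mulmxV// mul1mx addrK.
  by rewrite mxE; congr (_ + _); rewrite mxE mul_diag_mx mxE.
have u_w t : norm1 (u t) <= k2 * Num.sqrt (w t).
  by rewrite {1}uE; apply: norm1_mulmx => j; exact: coord_le_sqrt_sum.
have w_der : \forall t \near +oo, is_derive (t : R) 1 w (dw t).
  near=> t.
  have ut : forall i, is_derive (t : R) 1 (fun s => u s i 0) (du t i 0) by near: t.
  apply: is_derive_big_sum => i.
  have xt : is_derive (t : R) 1 (fun s => x s i 0) (h t i 0 - a 0 i * x t i 0).
    rewrite -dxE mxE; under eq_fun do rewrite mxE.
    by apply: is_derive_big_sum => j; exact: is_deriveZr.
  under eq_fun do rewrite expr2.
  apply: (is_derive_eq (is_deriveM xt xt)).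
  by rewrite /GRing.scale/=; ring.
pose C' := n%:R * (2 * (k1 * C) ^+ 2) / al.
have dw_le : \forall t \near +oo,
    dw t <= - (al / 2) * w t + C' * t `^ (- (2 * nu)).
  near=> t; set tau := t `^ (- (2 * nu)).
  have t0 : 0 < t by [].
  have tauE : tau = (t `^ (- nu)) ^+ 2.
    by rewrite /tau expr2 -powRD_gt0// -opprD -mulr2n mulr_natl.
  have h_le i : h t i 0 ^+ 2 <=
      2 * (k1 * k2) ^+ 2 * (eta ^+ 2 * w t) + 2 * (k1 * C) ^+ 2 * tau.
    pose s := Num.sqrt (w t); have s0 : 0 <= s by exact: sqrtr_ge0.
    have hi : `|h t i 0| <= (k1 * k2) * (eta * s) + (k1 * C) * t `^ (- nu).
      apply: (le_trans (coord_le_norm1 _ _)).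
      rewrite -!mulrA -mulrDr; apply: norm1_mulmx => j.
      have ut : forall i, `|(du t + A *m u t) i 0|
        <= eta * norm1 (u t) + C * t `^ (- nu) by near: t.
      apply: (le_trans (ut j)); rewrite lerD2r mulrCA ler_wpM2l ?(ltW eta0)//.
    rewrite -real_normK ?num_real//.
    apply: (@le_trans _ _ (((k1 * k2) * (eta * s) + (k1 * C) * t `^ (- nu)) ^+ 2)).
      by rewrite ler_sqr ?nnegrE// (le_trans _ hi).
    have -> : w t = s ^+ 2 by rewrite sqr_sqrtr.
    rewrite tauE -subr_ge0.
    rewrite (_ : _ - _ = ((k1 * k2) * (eta * s) - (k1 * C) * t `^ (- nu)) ^+ 2).
      exact: sqr_ge0.
    by ring.
  have term i : 2 * x t i 0 * (h t i 0 - a 0 i * x t i 0) <=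
      - al * x t i 0 ^+ 2 + (2 * (k1 * k2) ^+ 2 * (eta ^+ 2 * w t)
         + 2 * (k1 * C) ^+ 2 * tau) / al.
    apply: (@le_trans _ _ (- al * x t i 0 ^+ 2 + h t i 0 ^+ 2 / al)); last first.
      by rewrite lerD2l ler_wpM2r ?invr_ge0 ?(ltW al0).
    rewrite -subr_ge0.
    (* Completing the square in 2 x_i h_i <= al x_i^2 + h_i^2 / al. *)
    rewrite (_ : _ - _ = (al * x t i 0 - h t i 0) ^+ 2 / al
       + 2 * (a 0 i - al) * x t i 0 ^+ 2); last by field; rewrite gt_eqF.
    apply: addr_ge0; first by rewrite divr_ge0 ?sqr_ge0 ?(ltW al0).
    by rewrite mulr_ge0 ?sqr_ge0// mulr_ge0// subr_ge0.
  apply: (le_trans (ler_sum _ (fun i _ => term i))).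
  rewrite big_split/= -mulr_sumr -/(w t) sumr_const card_ord -[X in _ + X]mulr_natl.
  rewrite (_ : n%:R * _ = (Q * eta ^+ 2) * w t + C' * tau); last first.
    by rewrite /Q /C'; field; rewrite gt_eqF.
  have := ler_wpM2r (w0 t) Qeta; lra.
have w0_near : \forall t \near +oo, 0 <= w t by exact: nearW.
have al2 : 0 < al / 2 by rewrite divr_gt0.
have [K K_le] := damped_comparison al2 w0_near w_der dw_le.
exists (k2 * Num.sqrt `|K|); near=> t => i.
have t0 : 0 < t by [].
apply: (le_trans (coord_le_norm1 _ _)); apply: (le_trans (u_w t)).
rewrite -mulrA ler_wpM2l//.
have -> : t `^ (- nu) = Num.sqrt (t `^ (- (2 * nu))).
  rewrite -[LHS](ger0_norm (powR_ge0 _ _)) -sqrtr_sqr; congr Num.sqrt.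
  by rewrite expr2 -powRD_gt0// -opprD -mulr2n mulr_natl.
rewrite -sqrtrM// ler_wsqrtr//.
apply: (@le_trans _ _ (K * t `^ (- (2 * nu)))); first by near: t.
by rewrite ler_wpM2r ?powR_ge0// ler_norm.
Unshelve. all: by end_near. Qed.

(** The eta term makes the same estimate serve for linear systems and for the
    nonlinear equation, whose nonlinearity is eventually small against |u|. *)
Lemma damped_system_decay n (A : 'M[R]_n) : diagonalizable_pos A ->
  exists2 eta, 0 < eta & forall (u du g : R -> 'cV[R]_n) (nu : R),
    (\forall t \near +oo, forall i, is_derive (t : R) 1 (fun s => u s i 0) (du t i 0)) ->
    (\forall t \near +oo, forall i, `|(du t + A *m u t) i 0|
        <= eta * norm1 (u t) + `|g t i 0|) ->
    (forall i, decay nu (fun t => g t i 0)) ->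
    forall i, decay nu (fun t => u t i 0).
Proof.
move=> /damped_system[eta eta0 H]; exists eta => // u du g nu u_der u_le g_dec i.
move=> e e0; have e20 : 0 < e / 2 by rewrite divr_gt0.
have [|K K_le] := H u du (nu - e / 2) 1 u_der.
  have g_le : \forall t \near +oo, forall i, `|g t i 0| <= t `^ (e / 2 - nu).
    by apply: filter_forall => j; exact: g_dec.
  near=> t => j; apply: (@le_trans _ _ (eta * norm1 (u t) + `|g t j 0|)).
    by move: j; near: t.
  by rewrite mul1r opprB lerD2l; move: j; near: t.
near=> t; apply: (@le_trans _ _ (K * t `^ (- (nu - e / 2)))).
  by move: (i); near: t.
have t0 : 0 < t by [].
rewrite opprB (_ : e - nu = e / 2 + (e / 2 - nu)); last by rewrite addrA -splitr.
rewrite [leRHS]powRD_gt0// ler_wpM2r ?powR_ge0//.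
near: t; exact: powR_ge_near.
Unshelve. all: by end_near. Qed.

End Energy.
(** * The coefficients of the expansion *)

Section Coefficients.
Variables (R : realType) (n : nat) (A : 'M[R]_n).
Variable GG : forall m : nat, ('I_m -> 'cV[R]_n) -> 'cV[R]_n.
Arguments GG : clear implicits.
Variables (mu : nat -> R) (nn : nat -> nat).
Hypothesis GG_lin : forall m, (2 <= m)%N -> multilinear_map (GG m).
Hypothesis mu_seq : divergent_positive_increasing mu.
Local Notation coefs := (forall k : nat, 'rV[R]_(nn k) -> 'cV[R]_n).
Implicit Types (p q : coefs).

Definition nonlin_coef q k (z : 'rV[R]_(nn k)) : 'cV[R]_n :=
  \sum_(m \in [set m : nat | (2 <= m)%N])
     \sum_(j \in [set j : {ffun 'I_m -> nat} | \sum_(i < m) mu (j i) = mu k])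
       GG m (fun i => lift_vars (q (j i)) z).

(** The coefficient of - t^-(mu l + 1) in the derivative of the l-th term, written
    in m variables: chi needs it in more variables than q l has. *)
Definition shift_coef q l m (z : 'rV[R]_m) : 'cV[R]_n :=
  mu l *: lift_vars (q l) z
    - \sum_(j < m | (j < nn l)%N)
        (\prod_(i < m | (i < j)%N) z 0 i)^-1
          *: 'D_(delta_mx 0 j) (lift_vars (q l)) z.

Lemma shift_lt l k : mu l + 1 = mu k -> (l < k)%N.
Proof. by move=> lk; rewrite -(mu_ltE mu_seq) -lk ltrDl. Qed.

Lemma chi_shift q l k (z : 'rV[R]_(nn k)) :
  mu l + 1 = mu k -> chi mu q z = shift_coef q l z.
Proof.
move=> lk; rewrite /chi; case: pselect => [e|]; last by case; exists l.
case: cid => l' /= l'k; suff -> : l' = l by [].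
by apply: (mu_inj mu_seq); apply: (addIr 1); rewrite l'k lk.
Qed.

Lemma chi_eq0 q k (z : 'rV[R]_(nn k)) :
  (forall l, (l < k)%N -> mu l + 1 <> mu k) -> chi mu q z = 0.
Proof.
move=> H; rewrite /chi; case: pselect => // -[l lk].
by case: (H l (shift_lt lk) lk).
Qed.

(** The index l with mu l + 1 = mu k is smaller than k. *)
Lemma chi_ext q q' k (z : 'rV[R]_(nn k)) :
  (forall l, (l < k)%N -> q l = q' l) -> chi mu q z = chi mu q' z.
Proof.
move=> qq'.
have [[l lk]|nl] := pselect (exists l, mu l + 1 = mu k).
  by rewrite !(chi_shift _ _ lk) /shift_coef (qq' l (shift_lt lk)).
by rewrite !chi_eq0// => l _ lk; apply: nl; exists l.
Qed.

Lemma nonlin_coef_finite q k (z : 'rV[R]_(nn k)) B M :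
  (k <= B)%N -> mu k < mu 0%N *+ M.+1 ->
  nonlin_coef q z = \sum_(2 <= m < M.+1)
    \sum_(j : {ffun 'I_m -> 'I_B} | \sum_i mu (j i) == mu k)
      GG m (fun i => lift_vars (q (j i)) z).
Proof.
move=> kB kM; rewrite /nonlin_coef.
rewrite (nonlin_sum_finite mu_seq
  (fun m j => GG m (fun i : 'I_m => lift_vars (q (j i)) z)) kB kM).
apply: eq_bigr => m _; apply: eq_bigr => j _; congr (GG m _).
by apply/funext => i; rewrite ffunE.
Qed.

Lemma nonlin_coef_ext q q' k (z : 'rV[R]_(nn k)) :
  (forall l, (l < k)%N -> q l = q' l) -> nonlin_coef q z = nonlin_coef q' z.
Proof.
move=> qq'; have [M _ kM] := mu_natmul_ub mu_seq (mu k).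
have kM' : mu k < mu 0%N *+ M.+1.
  by apply: (le_lt_trans kM); rewrite mulrS ltrDr mu_gt0.
rewrite !(nonlin_coef_finite _ _ (leqnn k) kM').
apply: eq_bigr => m _; apply: eq_bigr => j _; congr (GG m _).
by apply/funext => i; rewrite qq'.
Qed.

Lemma nonlin_coef0 q (z : 'rV[R]_(nn 0)) : nonlin_coef q z = 0.
Proof.
have [M _ kM] := mu_natmul_ub mu_seq (mu 0%N).
have kM' : mu 0%N < mu 0%N *+ M.+1.
  by apply: (le_lt_trans kM); rewrite mulrS ltrDr mu_gt0.
rewrite (nonlin_coef_finite _ _ (leqnn 0%N) kM').
rewrite big_nat_cond big1// => m /andP[/andP[m2 _] _]; rewrite big1// => j _.
by have [] := j (Ordinal (ltnW m2)).
Qed.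

(** The first equation is not special: at k = 0 both the nonlinear sum and chi
    vanish. *)
Lemma coeff_recursionP p q : coeff_recursion A GG mu p q <->
  forall k z, orthant z -> q k z = invmx A *m (nonlin_coef q z + p k z + chi mu q z).
Proof.
split=> [[q0 qS] [|k] z z0|H].
- by rewrite q0// nonlin_coef0 add0r chi_eq0 ?addr0.
- exact: qS.
- split=> [z z0|k k0 z z0]; last exact: H.
  by rewrite H// nonlin_coef0 add0r chi_eq0 ?addr0.
Qed.

(** The recursion is course-of-values in a family of dependent type; iterating its
    right-hand side on whole families avoids building the family index by index.
    The k-th member is final after k + 1 rounds. *)
Fixpoint coef_iter p (s : nat) : coefs :=
  if s is s'.+1 then fun k z =>
    invmx A *m (nonlin_coef (coef_iter p s') z + p k z + chi mu (coef_iter p s') z)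
  else fun k z => 0.
Arguments coef_iter : clear implicits.

Lemma coef_iter_stable p k s s' : (k < s)%N -> (k < s')%N ->
  coef_iter p s k = coef_iter p s' k.
Proof.
elim/ltn_ind: k s s' => k IH [//|s] [//|s'] ks ks'; apply/funext => z /=.
have E l : (l < k)%N -> coef_iter p s l = coef_iter p s' l.
  by move=> lk; apply: IH => //; exact: leq_trans lk _.
by rewrite (nonlin_coef_ext _ E) (chi_ext _ E).
Qed.

Lemma coeff_recursion_exists p : exists q, coeff_recursion A GG mu p q.
Proof.
exists (fun k => coef_iter p k.+1 k); apply/coeff_recursionP => k z z0 /=.
have E l : (l < k)%N -> coef_iter p k l = coef_iter p l.+1 l.
  by move=> lk; exact: coef_iter_stable.
by rewrite (nonlin_coef_ext (q' := fun k => coef_iter p k.+1 k) _ E)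
  (chi_ext (q' := fun k => coef_iter p k.+1 k) _ E).
Qed.

(** Derivatives of power-like functions and inverse coordinates are power-like. *)
Lemma powerlike_shift q l m : powerlike (q l) ->
  powerlike (shift_coef q l (m := m)).
Proof.
move=> ql; have qm : powerlike (lift_vars (q l) : 'rV[R]_m -> _) by exact: powerlike_lift.
have [Dq _] := powerlike_chain qm.
apply/powerlike_coord => i.
apply: (@spl_eq _ _ (fun z : 'rV[R]_m => mu l * lift_vars (q l) z i 0 +
   - \sum_(j < m | (j < nn l)%N)
        (\prod_(i < m | (i < j)%N) (z 0 i)^-1)
          * 'D_(delta_mx 0 j) (lift_vars (q l)) z i 0)).
  move=> z z0; rewrite /shift_coef !mxE summxE; congr (_ - _).
  by apply: eq_bigr => j _; rewrite mxE prodfV.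
apply: splD; first by apply: splZ; move/powerlike_coord : qm; apply.
apply: splN; apply: spl_sum => j _; apply: splM.
  by apply: spl_prod => i' _; exact: spl_coord_inv.
by move/powerlike_coord : (Dq j); apply.
Qed.

Lemma powerlike_chi q k : (forall l, (l < k)%N -> powerlike (q l)) ->
  powerlike (chi mu q (k := k)).
Proof.
move=> ql; have [[l lk]|nl] := pselect (exists l, mu l + 1 = mu k).
  rewrite (_ : chi mu q (k := k) = shift_coef q l (m := nn k)).
    by apply: powerlike_shift; apply: ql; exact: shift_lt.
  by apply/funext => z; exact: chi_shift.
rewrite (_ : chi mu q (k := k) = fun=> 0).
  by apply/powerlike_coord => i; under eq_fun do rewrite mxE; exact: spl_cst.
by apply/funext => z; apply: chi_eq0 => l _ lk; apply: nl; exists l.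
Qed.

Lemma powerlike_nonlin_coef q k : (forall l, (l < k)%N -> powerlike (q l)) ->
  powerlike (nonlin_coef q (k := k)).
Proof.
move=> ql; have [M _ kM] := mu_natmul_ub mu_seq (mu k).
have kM' : mu k < mu 0%N *+ M.+1.
  by apply: (le_lt_trans kM); rewrite mulrS ltrDr mu_gt0.
apply/powerlike_coord => i.
apply: (@spl_eq _ _ (fun z => \sum_(2 <= m < M.+1 | (2 <= m < M.+1)%N)
    \sum_(j : {ffun 'I_m -> 'I_k} | \sum_i mu (j i) == mu k)
      GG m (fun i => lift_vars (q (j i)) z) i 0)).
  move=> z _; rewrite (nonlin_coef_finite _ _ (leqnn k) kM') -big_nat summxE.
  by apply: eq_bigr => m _; rewrite summxE.
apply: spl_sum => m /andP[m2 _]; apply: spl_sum => j _.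
have := multilinear_powerlike (GG_lin m2)
  (p := fun i => lift_vars (q (j i)) : 'rV[R]_(nn k) -> _).
by move/(_ (fun i => powerlike_lift _ (ql _ (ltn_ord _))))/powerlike_coord; apply.
Qed.

Lemma powerlike_mulmx (B : 'M[R]_n) k (r : 'rV[R]_k -> 'cV[R]_n) :
  powerlike r -> powerlike (fun z => B *m r z).
Proof.
move=> /powerlike_coord rP; apply/powerlike_coord => i.
apply: (@spl_eq _ _ (fun z => \sum_j B i j * r z j 0)).
  by move=> z _; rewrite mxE.
by apply: spl_sum => j _; exact: splZ.
Qed.

Lemma powerlike_add k (r s : 'rV[R]_k -> 'cV[R]_n) :
  powerlike r -> powerlike s -> powerlike (fun z => r z + s z).
Proof.
move=> /powerlike_coord rP /powerlike_coord sP; apply/powerlike_coord => i.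
by under eq_fun do rewrite mxE; exact: splD.
Qed.

Lemma powerlike_eq k (r s : 'rV[R]_k -> 'cV[R]_n) :
  (forall z, orthant z -> r z = s z) -> powerlike r -> powerlike s.
Proof.
move=> rs [I [c [I0 rE]]]; exists I, c; split=> // z z0.
by rewrite -rs// rE.
Qed.

Lemma powerlike_coefs p q : (forall k, powerlike (p k)) ->
  coeff_recursion A GG mu p q -> forall k, powerlike (q k).
Proof.
move=> pP /coeff_recursionP qE; elim/ltn_ind => k IH.
apply: (@powerlike_eq _ (fun z => invmx A *m (nonlin_coef q z + p k z + chi mu q z))).
  by move=> z z0; rewrite qE.
apply: powerlike_mulmx; apply: powerlike_add; last exact: powerlike_chi.
by apply: powerlike_add; first exact: powerlike_nonlin_coef.
Qed.

Definition expansion_term q k (t : R) : 'cV[R]_n :=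
  t `^ (- mu k) *: q k (logvec (nn k) t).

Lemma decay_powerlike_term a k (r : 'rV[R]_k -> 'cV[R]_n) : powerlike r ->
  forall i, decay a (fun t => (t `^ (- a) *: r (logvec k t)) i 0).
Proof.
move=> /powerlike_coord rP i; under eq_fun do rewrite mxE.
by have := decayM (decay_powR (- a)) (spl_decay (rP i)); rewrite opprK addr0.
Qed.

Lemma lift_vars_logvec q l m (t : R) : (nn l <= m)%N ->
  lift_vars (q l) (logvec m t) = q l (logvec (nn l) t).
Proof. by move=> lm; rewrite /lift_vars trunc_vars_logvec. Qed.

(** The power contributes - mu l, the chain rule along the iterated logarithms the
    sum over j; a common factor t^-(mu l + 1) comes out. *)
Lemma expansion_term_derive q l m : powerlike (q l) -> (nn l <= m)%N ->
  \forall t \near +oo, forall i,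
    is_derive (t : R) 1 (fun s => expansion_term q l s i 0)
      (- (t `^ (- (mu l + 1)) *: shift_coef q l (logvec m t)) i 0).
Proof.
move=> ql lm; have qm : powerlike (lift_vars (q l) : 'rV[R]_m -> _) by exact: powerlike_lift.
have [_ chain] := powerlike_chain qm.
near=> t => i.
have t0 : 0 < t by [].
have logs0 : forall j, (j <= m)%N -> 0 < iterlog j t.
  by near: t; exact: near_iterlogs_gt0.
have orth : orthant (logvec m t) by near: t; exact: near_logvec_orthant.
have dlog (j : 'I_m) : is_derive t 1 (fun s => logvec m s 0 j)
    (t * \prod_(i < j) iterlog i.+1 t)^-1.
  under eq_fun do rewrite mxE; apply: is_derive_iterlog => j' j'j.
  by apply: logs0; rewrite (leq_trans j'j)// ltnW.
have D1 := chain _ _ t orth dlog i.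
have D2 := is_derive_mul (is_derive1_powR (- mu l) t0) D1.
have fE : (fun s => expansion_term q l s i 0) =
    (fun s => s `^ (- mu l) * lift_vars (q l) (logvec m s) i 0).
  apply/funext => s.
  by rewrite /expansion_term mxE -(lift_vars_logvec q s lm).
rewrite fE; apply: (is_derive_eq D2).
rewrite !mxE summxE.
have -> : t `^ (- (mu l + 1)) = t `^ (- mu l) * t^-1.
  by rewrite opprD powRD_gt0// powR_inv1// ltW.
have -> : t `^ (- mu l - 1) = t `^ (- mu l) * t^-1.
  by rewrite powRD_gt0// powR_inv1// ltW.
pose D (j : 'I_m) := 'D_(delta_mx 0 j) (lift_vars (q l)) (logvec m t) i 0.
have -> : \sum_(j < m) (t * \prod_(i0 < j) iterlog i0.+1 t)^-1 *
      'D_(delta_mx 0 j) (lift_vars (q l)) (logvec m t) i 0 =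
    t^-1 * \sum_(j < m | (j < nn l)%N)
      (\prod_(i < m | (i < j)%N) logvec m t 0 i)^-1 * D j.
  rewrite mulr_sumr [RHS]big_mkcond; apply: eq_bigr => j _.
  case: ltnP => jl; last by rewrite derive_lift_vars0// mxE mulr0.
  rewrite invfM -mulrA; congr (_ * (_^-1 * _)).
  rewrite (big_ord_widen m (fun i => iterlog i.+1 t)) ?(ltnW (ltn_ord j))//.
  by apply: eq_bigr => i' _; rewrite mxE.
rewrite [X in _ = - (_ * (_ - X))](_ : _ = \sum_(j < m | (j < nn l)%N)
      (\prod_(i < m | (i < j)%N) logvec m t 0 i)^-1 * D j); last first.
  by apply: eq_bigr => j _; rewrite mxE.
by ring.
Unshelve. all: by end_near. Qed.

(** Whatever the number of variables, the value along the logarithms is determined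
    by the derivative of one and the same function of t. *)
Lemma shift_coef_level q l m : powerlike (q l) -> (nn l <= m)%N ->
  \forall t \near +oo, shift_coef q l (logvec m t) = shift_coef q l (logvec (nn l) t).
Proof.
move=> ql lm; near=> t; apply/colP => i.
have t0 : 0 < t by [].
have Dm : forall i, is_derive t 1 (fun s => expansion_term q l s i 0)
      (- (t `^ (- (mu l + 1)) *: shift_coef q l (logvec m t)) i 0).
  by near: t; exact: expansion_term_derive.
have Dl : forall i, is_derive t 1 (fun s => expansion_term q l s i 0)
      (- (t `^ (- (mu l + 1)) *: shift_coef q l (logvec (nn l) t)) i 0).
  by near: t; exact: expansion_term_derive.
have [_ e1] := Dm i; have [_] := Dl i; rewrite e1 => /oppr_inj.
rewrite !mxE => /mulfI; apply.
by rewrite gt_eqF// powR_gt0.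
Unshelve. all: by end_near. Qed.

End Coefficients.
(** * Expansions as decay of remainders *)

Section Expansions.
Variables (R : realType) (n : nat).

Lemma coordD (u v : 'cV[R]_n) i : (u + v) i 0 = u i 0 + v i 0.
Proof. by rewrite mxE. Qed.

Lemma coordB (u v : 'cV[R]_n) i : (u - v) i 0 = u i 0 - v i 0.
Proof. by rewrite !mxE. Qed.

Lemma enorm_le_norm1 (x : 'cV[R]_n) : enorm x <= norm1 x.
Proof.
rewrite -[leRHS]ger0_norm ?norm1_ge0// -sqrtr_sqr ler_wsqrtr//.
rewrite expr2 {1}/norm1 mulr_suml; apply: ler_sum => i _.
by rewrite -real_normK ?num_real// expr2 ler_wpM2l// coord_le_norm1.
Qed.

Lemma coord_le_enorm (x : 'cV[R]_n) i : `|x i 0| <= enorm x.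
Proof. exact: coord_le_sqrt_sum. Qed.

(** Stopping the sum before the N-th term leaves exactly the order of that term, up
    to logarithms. Conversely, decay mu (N + 1) after N + 1 terms gives any power
    strictly between mu N and mu (N + 1). *)
Lemma asym_expansionP (g : R -> 'cV[R]_n) (nn : nat -> nat)
    (q : forall k, 'rV[R]_(nn k) -> 'cV[R]_n) (mu : nat -> R) :
  {homo mu : i j / (i < j)%N >-> i < j} -> (forall k, powerlike (q k)) ->
  asym_expansion g q mu <-> forall N i,
    decay (mu N) (fun t => (g t - \sum_(k < N) expansion_term mu q k t) i 0).
Proof.
move=> mu_lt qP; split=> [gq N i|gq N].
  have [nu nuN [T [C [T0 C0 gle]]]] := gq N.
  have d1 : decay (mu N)
      (fun t => (g t - \sum_(k < N.+1) expansion_term mu q k t) i 0).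
    apply: (@decay_of_bound _ _ nu C); first exact: ltW.
    near=> t; apply: (le_trans (coord_le_enorm _ _)); apply: gle.
    by near: t; exact: near_pinfty_ge.
  apply: decay_near_eq (decayD d1 (decay_powerlike_term (mu N) (qP N) i)).
  near=> t; rewrite -coordD; congr (_ i 0).
  by rewrite big_ord_recr/= opprD addrA subrK.
(* The midpoint of mu N and mu (N + 1) is the exponent of the bound. *)
pose e := (mu N.+1 - mu N) / 2.
have e0 : 0 < e by rewrite divr_gt0// subr_gt0 mu_lt.
exists (mu N + e); first by rewrite ltrDl.
have : \forall t \near +oo, forall i,
    `|(g t - \sum_(k < N.+1) expansion_term mu q k t) i 0| <= t `^ (e - mu N.+1).
  by apply: filter_forall => i; exact: gq.
move=> [T [_ TP]]; exists (Num.max T 0 + 1), (n%:R + 1); split.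
- by rewrite ltr_pwDr// le_max lexx orbT.
- by rewrite ltr_wpDl.
move=> t Tt; have tT : T < t.
  by apply: lt_le_trans Tt; rewrite ltr_pwDr// le_max lexx.
apply: (le_trans (enorm_le_norm1 _)).
apply: (@le_trans _ _ (\sum_(i < n) t `^ (e - mu N.+1))).
  by apply: ler_sum => i _; exact: TP.
rewrite sumr_const card_ord -[leLHS]mulr_natl.
rewrite (_ : - (mu N + e) = e - mu N.+1); last by rewrite /e; field.
by rewrite ler_wpM2r ?powR_ge0// lerDl.
Unshelve. all: by end_near. Qed.

(** The cancellation scheme of the recursion: terms whose exponent s i is among the
    values e k are collected by exponent, the others are left over. *)
Lemma sum_by_value (I : finType) (V : zmodType) (B : nat) (s : I -> R) (e : 'I_B -> R)
    (F : I -> V) : injective e ->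
  \sum_i F i = \sum_k \sum_(i | s i == e k) F i
    + \sum_(i | ~~ [exists k, s i == e k]) F i.
Proof.
move=> e_inj; rewrite (bigID (fun i => [exists k, s i == e k]))/=; congr (_ + _).
under [RHS]eq_bigr do rewrite big_mkcond/=.
rewrite exchange_big big_mkcond; apply: eq_bigr => i _ /=.
rewrite -big_mkcond; case: existsP => [[k0 /eqP sk0]|nk].
  rewrite (big_pred1 k0)// => k; rewrite sk0 (inj_eq e_inj) eq_sym//.
by rewrite big_pred0// => k; apply/negP => sk; apply: nk; exists k.
Qed.

End Expansions.

(** * The expansion of the solution *)

Section Main.
Variables (R : realType) (n : nat) (A : 'M[R]_n).
Hypothesis A_diag : diagonalizable_pos A.
Variables (G : 'cV[R]_n -> 'cV[R]_n) (Gm : nat -> 'cV[R]_n -> 'cV[R]_n).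
Hypothesis G_exp : nonlin_expansion G Gm.
Variable GG : forall m : nat, ('I_m -> 'cV[R]_n) -> 'cV[R]_n.
Arguments GG : clear implicits.
Hypothesis GG_lin : forall m, (2 <= m)%N -> multilinear_map (GG m).
Hypothesis GG_diag : forall m, (2 <= m)%N -> forall y, Gm m y = GG m (fun=> y).
Variable mu : nat -> R.
Hypothesis mu_seq : divergent_positive_increasing mu.
Hypothesis mu_add : forall x y, range mu x -> range mu y -> range mu (x + y).
Hypothesis mu_succ : forall x, range mu x -> range mu (x + 1).
Variable nn : nat -> nat.
Hypothesis nn_homo : {homo nn : i j / (i <= j)%N}.
Variable f : R -> 'cV[R]_n.
Variable p : forall k : nat, 'rV[R]_(nn k) -> 'cV[R]_n.
Arguments p : clear implicits.
Hypothesis p_powerlike : forall k, powerlike (p k).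
Hypothesis f_exp : asym_expansion f p mu.
Variables (T0 : R) (y : R -> 'cV[R]_n).
Hypothesis y_derivable : forall t, T0 < t -> derivable y t 1.
Hypothesis y_ode : forall t, T0 < t -> derive1 y t = - (A *m y t) + G (y t) + f t.
Hypothesis y_to0 : y t @[t --> +oo] --> (0 : 'cV[R]_n).
Variable q : forall k : nat, 'rV[R]_(nn k) -> 'cV[R]_n.
Arguments q : clear implicits.
Hypothesis q_rec : coeff_recursion A GG mu p q.

Let Y := expansion_term mu q.
Let P := expansion_term mu p.
Let ypart N t := \sum_(k < N) Y k t.

Lemma q_powerlike k : powerlike (q k).
Proof. exact: (powerlike_coefs GG_lin mu_seq p_powerlike q_rec). Qed.

Lemma mu_homo : {homo mu : i j / (i < j)%N >-> i < j}.
Proof. by case: mu_seq. Qed.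

Lemma y_is_derive t i : T0 < t ->
  is_derive t 1 (fun s => y s i 0) (derive1 y t i 0).
Proof.
move=> /y_derivable yt; have /derivable_mxP yti := yt.
by rewrite derive1E derive_mx// mxE; apply/derivableP; exact: yti.
Qed.

Lemma y_near0 (U : set 'cV[R]_n) : nbhs (0 : 'cV[R]_n) U -> \forall t \near +oo, U (y t).
Proof. exact: y_to0. Qed.

Lemma y_small e : 0 < e -> \forall t \near +oo, norm1 (y t) <= e.
Proof.
move=> e0; have n1 : 0 < n%:R + 1 :> R by rewrite ltr_wpDl.
have en0 : 0 < e / (n%:R + 1) by rewrite divr_gt0.
have /cvgr0Pnorm_le := y_to0.
move=> /(_ _ en0); apply: filterS => t yt.
apply: (@le_trans _ _ (\sum_(i < n) e / (n%:R + 1))).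
  apply: ler_sum => i _; apply: le_trans yt.
  by rewrite [leRHS]/Num.Def.normr/= mx_normrE (le_bigmax _ _ (i, 0)).
rewrite sumr_const card_ord -[leLHS]mulr_natl mulrA ler_pdivrMr// mulrC.
by rewrite ler_wpM2l ?(ltW e0)// lerDl.
Unshelve. all: by end_near. Qed.

Lemma forcing_decay N i : decay (mu N) (fun t => (f t - \sum_(k < N) P k t) i 0).
Proof. exact: ((asym_expansionP f mu_homo p_powerlike).1 f_exp N i). Qed.

Lemma G_remainder M : (2 <= M)%N -> exists2 C, 0 < C & \forall t \near +oo, forall i,
  `|(G (y t) - \sum_(2 <= m < M.+1) Gm m (y t)) i 0| <= C * norm1 (y t) ^+ M.
Proof.
move=> M2; have [d [C [d0 C0 /y_near0 H]]] := G_exp M2.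
exists C => //; near=> t => i.
apply: (le_trans (coord_le_enorm _ _)).
apply: (@le_trans _ _ (C * enorm (y t) `^ (M%:R + d))); first by near: t.
have yle := enorm_le_norm1 (y t).
have y0 : 0 <= enorm (y t) by exact: sqrtr_ge0.
rewrite ler_wpM2l ?(ltW C0)// -powR_mulrn ?norm1_ge0//.
apply: (@le_trans _ _ (norm1 (y t) `^ (M%:R + d))).
  by apply: ge0_ler_powR; rewrite ?nnegrE ?norm1_ge0// addr_ge0// ltW.
have [->|nz] := eqVneq (norm1 (y t)) 0.
  by rewrite !powR0 ?gt_eqF// ?ltr_wpDl// ltr0n (leq_trans _ M2).
apply: ger_powR; last by rewrite lerDl ltW.
rewrite lt_neqAle eq_sym nz norm1_ge0/=.
by near: t; exact: y_small.
Unshelve. all: by end_near. Qed.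

(** Degree 2 is the lowest degree in the expansion of G. *)
Lemma G_quadratic : exists2 C, 0 < C & \forall t \near +oo, forall i,
  `|G (y t) i 0| <= C * norm1 (y t) ^+ 2.
Proof.
have [C C0 H] := G_remainder (leqnn 2).
have [I [kk rep]] := multilinear_repr R n 2.
have [c cP] := rep _ (GG_lin (leqnn 2)).
pose C' := \sum_x norm1 (c x).
have C'0 : 0 <= C' by apply: sumr_ge0 => x _; exact: norm1_ge0.
exists (C + C'); first by rewrite ltr_pwDl.
near=> t => i.
have -> : G (y t) i 0 = (G (y t) - \sum_(2 <= m < 3) Gm m (y t)) i 0 + Gm 2 (y t) i 0.
  by rewrite big_nat1 !mxE subrK.
apply: (le_trans (ler_normD _ _)); rewrite mulrDl; apply: lerD.
  by move: i; near: t.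
rewrite GG_diag// cP summxE (le_trans (ler_norm_sum _ _ _))// mulr_suml.
apply: ler_sum => x _; rewrite mxE mulrC normrM ler_pM ?coord_le_norm1//.
rewrite big_ord_recl big_ord1 normrM expr2 ler_pM ?coord_le_norm1//.
Unshelve. all: by end_near. Qed.

(** Since y tends to 0, the quadratic bound makes G(y) smaller than eta |y|, and
    the damped system sees the decay of f. *)
Lemma y_decay i : decay (mu 0%N) (fun t => y t i 0).
Proof.
have [eta eta0 H] := damped_system_decay A_diag.
have [C C0 GC] := G_quadratic.
have fd j : decay (mu 0%N) (fun t => f t j 0).
  apply: decay_near_eq (forcing_decay 0 j); near=> t.
  by rewrite big_ord0 subr0.
move: i; apply: (H y (derive1 y) f) => //.
  by near=> t => i; apply: y_is_derive; near: t; exact: near_pinfty_gt.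
near=> t => i.
have tT : T0 < t by near: t; exact: near_pinfty_gt.
rewrite y_ode// (_ : _ + A *m y t = G (y t) + f t); last first.
  by rewrite addrC !addrA subrr add0r.
rewrite mxE (le_trans (ler_normD _ _))// lerD2r.
apply: (@le_trans _ _ (C * norm1 (y t) ^+ 2)); first by move: i; near: t.
rewrite expr2 mulrA ler_wpM2r ?norm1_ge0// mulrC -ler_pdivlMr//.
by near: t; apply: y_small; rewrite divr_gt0.
Unshelve. all: by end_near. Qed.

Lemma ypart_decay N i : decay (mu 0%N) (fun t => ypart N t i 0).
Proof.
apply: (@decay_near_eq _ _ (fun t => \sum_(k < N) Y k t i 0)).
  by near=> t; rewrite summxE.
apply: decay_sum => k _; apply: decay_le (decay_powerlike_term _ (q_powerlike k) i).
exact: mu_le.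
Unshelve. all: by end_near. Qed.

(** Closure of the exponents under addition: mu 0 + mu N is an exponent beyond
    mu N. *)
Lemma mu_next_le N : mu N.+1 <= mu 0%N + mu N.
Proof.
have [l _ lE] : range mu (mu 0%N + mu N) by apply: mu_add; [exists 0%N|exists N].
rewrite -lE (mu_le mu_seq)// -(mu_ltE mu_seq) lE.
by rewrite ltrDr mu_gt0.
Qed.

(** The Taylor remainder is beyond mu (N + 1) by the choice of M; replacing y by
    the partial sum gains mu 0 over the error mu N. *)
Lemma nonlin_decay N M : (2 <= M)%N -> mu N.+1 <= mu 0%N *+ M ->
  (forall i, decay (mu N) (fun t => (y t - ypart N t) i 0)) ->
  forall i, decay (mu N.+1)
    (fun t => (G (y t) - \sum_(2 <= m < M.+1) GG m (fun=> ypart N.+1 t)) i 0).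
Proof.
move=> M2 NM yN i.
have yN1 j : decay (mu N) (fun t => (y t - ypart N.+1 t) j 0).
  apply: decay_near_eq (decayB (yN j) (decay_powerlike_term _ (q_powerlike N) j)).
  near=> t; rewrite /ypart big_ord_recr/= opprD addrA.
  by rewrite coordB.
have norm1_decay : decay (mu 0%N) (fun t => norm1 (y t)).
  apply: decay_sum => j _; apply: decay_near (y_decay j).
  by near=> t; rewrite normr_id.
have rem : decay (mu N.+1) (fun t => (G (y t) - \sum_(2 <= m < M.+1) Gm m (y t)) i 0).
  have [C C0 H] := G_remainder M2.
  apply: (@decay_near _ _ (fun t => C * \prod_(j < M) norm1 (y t))).
    near=> t; rewrite prodr_const card_ord [leRHS]ger0_norm; last first.
      by rewrite mulr_ge0 ?exprn_ge0 ?norm1_ge0// ltW.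
    by move: i; near: t.
  apply: decayZ; apply: (decay_le NM).
  rewrite -{1}(card_ord M) -sumr_const.
  by apply: decay_prod.
have lin : decay (mu N.+1) (fun t => \sum_(2 <= m < M.+1 | (2 <= m < M.+1)%N)
    (GG m (fun=> y t) - GG m (fun=> ypart N.+1 t)) i 0).
  apply: decay_sum => m /andP[m2 _]; apply: (decay_le (mu_next_le N)).
  apply: decay_multilinear_sub => //; first exact: GG_lin.
  - by rewrite ltW// mu_gt0.
  - exact: y_decay.
  - exact: ypart_decay.
apply: decay_near_eq (decayD rem lin); near=> t.
rewrite -big_nat -summxE sumrB -coordD; congr (_ i 0).
rewrite (_ : \sum_(2 <= m < M.+1) GG m (fun=> y t) = \sum_(2 <= m < M.+1) Gm m (y t)).
  by rewrite addrA subrK.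
by apply: eq_big_nat => m /andP[m2 _]; rewrite GG_diag.
Unshelve. all: by end_near. Qed.

Lemma range_sum_mu m (j : 'I_m.+1 -> nat) : range mu (\sum_i mu (j i)).
Proof.
elim: m j => [|m IH] j; first by rewrite big_ord1; exists (j ord0).
by rewrite big_ord_recr; apply: mu_add; [exact: IH|exists (j ord_max)].
Qed.

(** What turns every uncancelled term into a negligible one. *)
Lemma range_ge_next N x : range mu x -> (forall k, (k < N.+1)%N -> x != mu k) ->
  mu N.+1 <= x.
Proof.
move=> [l _ <-] xk; apply: (mu_le mu_seq); rewrite ltnNge; apply/negP => lN.
by have /eqP := xk l lN.
Qed.

(** Multilinearity distributes t^-(mu k) over the arguments, because the exponents
    of the arguments add up to mu k. *)
Lemma nonlin_term t N M k : 0 < t -> (k < N.+1)%N -> mu k < mu 0%N *+ M.+1 ->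
  t `^ (- mu k) *: nonlin_coef GG mu q (logvec (nn k) t)
  = \sum_(2 <= m < M.+1) \sum_(j : {ffun 'I_m -> 'I_N.+1} | \sum_i mu (j i) == mu k)
      GG m (fun i => Y (j i) t).
Proof.
move=> t0 kN kM; rewrite (nonlin_coef_finite GG mu_seq q _ (ltnW kN) kM).
rewrite scaler_sumr; apply: eq_big_nat => m /andP[m2 _].
rewrite scaler_sumr; apply: eq_bigr => j /eqP jk.
have powE : t `^ (- mu k) = \prod_i t `^ (- mu (j i)).
  rewrite -jk -sumrN; elim/big_rec2 : _ => [|i a b _ <-]; first exact: powRr0.
  by rewrite powRD_gt0.
rewrite powE -multilinear_scale; last exact: GG_lin.
congr (GG m _); apply/funext => i; rewrite /Y /expansion_term lift_vars_logvec//.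
by apply: nn_homo; apply: ltnW; exact: (sum_mu_index_lt mu_seq m2 jk).
Qed.

(** Expanding the polynomials at the partial sum gives one term per multi-index. The
    recursion cancels those with exponent mu k, k <= N; the exponents of the others
    are sums of elements of a set closed under addition. *)
Lemma nonlin_sum_decay N M : mu N.+1 <= mu 0%N *+ M ->
  forall i, decay (mu N.+1) (fun t =>
    (\sum_(2 <= m < M.+1) GG m (fun=> ypart N.+1 t)
     - \sum_(k < N.+1) t `^ (- mu k) *: nonlin_coef GG mu q (logvec (nn k) t)) i 0).
Proof.
move=> NM i.
pose res m (j : {ffun 'I_m -> 'I_N.+1}) :=
  ~~ [exists k : 'I_N.+1, \sum_i mu (j i) == mu k].
have : decay (mu N.+1) (fun t => \sum_(2 <= m < M.+1 | (2 <= m < M.+1)%N)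
    \sum_(j | res m j) GG m (fun i => Y (j i) t) i 0).
  apply: decay_sum => m /andP[m2 _]; apply: decay_sum => j resj.
  apply: decay_le (decay_multilinear (a := fun l => mu (j l)) (GG_lin m2) _ i); last first.
    by move=> l i'; exact: (decay_powerlike_term _ (q_powerlike (j l)) i').
  apply: range_ge_next.
    case: m m2 j resj => [//|m] _ j _.
    exact: (range_sum_mu (fun l => j l)).
  move=> k kN; apply: contra resj => jk; apply/existsP.
  by exists (Ordinal kN).
apply: decay_near_eq; near=> t; have t0 : 0 < t by [].
rewrite -big_nat.
transitivity ((\sum_(2 <= m < M.+1) \sum_(j | res m j)
    GG m (fun i => Y (j i) t)) i 0); last first.
  by rewrite summxE; apply: eq_bigr => m _; rewrite summxE.
congr (_ i 0).
rewrite (_ : \sum_(2 <= m < M.+1) GG m (fun=> ypart N.+1 t) =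
    \sum_(k < N.+1) t `^ (- mu k) *: nonlin_coef GG mu q (logvec (nn k) t)
    + \sum_(2 <= m < M.+1) \sum_(j | res m j) GG m (fun i => Y (j i) t)).
  by rewrite addrAC subrr add0r.
have termE k : (k < N.+1)%N -> t `^ (- mu k) *: nonlin_coef GG mu q (logvec (nn k) t)
  = \sum_(2 <= m < M.+1) \sum_(j : {ffun 'I_m -> 'I_N.+1} | \sum_i mu (j i) == mu k)
      GG m (fun i => Y (j i) t).
  move=> kN; apply: nonlin_term => //.
  apply: (lt_le_trans (mu_homo kN)); apply: (le_trans NM).
  by rewrite ler_wpMn2l ?(ltW (mu_gt0 mu_seq _)).
rewrite (eq_bigr _ (fun (k : 'I_N.+1) _ => termE k (ltn_ord k))).
rewrite exchange_big -big_split; apply: eq_big_nat => m /andP[m2 _] /=.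
rewrite /ypart (multilinear_expand _ (GG_lin m2)).
apply: sum_by_value => k k' kk'; apply: val_inj; exact: (mu_inj mu_seq).
Unshelve. all: by end_near. Qed.

Definition term_deriv k (t : R) : 'cV[R]_n :=
  - (t `^ (- (mu k + 1)) *: shift_coef mu q k (logvec (nn k) t)).

(** Differentiating the k-th term raises its exponent to mu k + 1. If that is the
    exponent of a term of the partial sum, chi cancels it; otherwise it is beyond
    mu N, the exponents being closed under adding 1. *)
Lemma shift_sum_decay N i : decay (mu N.+1) (fun t =>
  (\sum_(k < N.+1) t `^ (- mu k) *: chi mu q (logvec (nn k) t)
   + \sum_(k < N.+1) term_deriv k t) i 0).
Proof.
pose res (k : 'I_N.+1) := ~~ [exists k' : 'I_N.+1, mu k + 1 == mu k'].
have : decay (mu N.+1) (fun t => \sum_(k | res k) term_deriv k t i 0).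
  have shiftP k : powerlike (shift_coef mu q k (m := nn k)).
    by apply: powerlike_shift; exact: q_powerlike.
  apply: decay_sum => k resk.
  apply: (@decay_near_eq _ _ (fun t =>
    - (t `^ (- (mu k + 1)) *: shift_coef mu q k (logvec (nn k) t)) i 0)).
    by near=> t; rewrite /term_deriv mxE.
  apply: decayN; apply: decay_le (decay_powerlike_term _ (shiftP k) i).
  apply: range_ge_next; first by apply: mu_succ; exists k.
  move=> k' kN; apply: contra resk => kk'; apply/existsP.
  by exists (Ordinal kN).
apply: decay_near_eq; near=> t; have t0 : 0 < t by [].
have level : forall k k' : 'I_N.+1, (k <= k')%N ->
    shift_coef mu q k (logvec (nn k') t) = shift_coef mu q k (logvec (nn k) t).
  near: t; apply: filter_forall => k; apply: filter_forall => k'.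
  have [kk'|_] := leqP k k'; last by near=> t.
  have := shift_coef_level mu (q_powerlike k) (nn_homo kk').
  by apply: filterS => t.
rewrite -summxE; congr (_ i 0).
rewrite (sum_by_value (fun k : 'I_N.+1 => mu k + 1) (fun k => term_deriv k t)
  (e := fun k : 'I_N.+1 => mu k)); last first.
  by move=> k k' kk'; apply: val_inj; exact: (mu_inj mu_seq).
rewrite addrA -big_split/= big1 ?add0r// => k _.
have [[l lk]|nl] := pselect (exists l, mu l + 1 = mu k); last first.
  rewrite chi_eq0// ?scaler0 ?add0r; last by move=> l _ lk; apply: nl; exists l.
  by rewrite big_pred0// => l; apply/negP => /eqP lk; apply: nl; exists l.
have lk' := shift_lt mu_seq lk.
have lN : (l < N.+1)%N := ltn_trans lk' (ltn_ord k).
rewrite (big_pred1 (Ordinal lN)) => [|l' /=]; last first.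
  rewrite -lk (inj_eq (addIr _)) (inj_eq (mu_inj mu_seq)).
  by apply/eqP/eqP => [?|->//]; exact: val_inj.
rewrite (chi_shift mu_seq q _ lk) (level (Ordinal lN) k (ltnW lk')) /term_deriv/=.
by rewrite lk subrr.
Unshelve. all: by end_near. Qed.

Lemma A_unit : A \in unitmx.
Proof.
have [S [a [Su a0 ->]]] := A_diag.
rewrite !unitmx_mul unitmx_inv Su/= andbT unitmxE det_diag unitfE.
by apply/prodf_neq0 => i _; rewrite gt_eqF.
Qed.

Lemma mulmx_term N t : (forall k, (k < N)%N -> orthant (logvec (nn k) t)) ->
  A *m ypart N t = \sum_(k < N) t `^ (- mu k) *: nonlin_coef GG mu q (logvec (nn k) t)
    + \sum_(k < N) P k t + \sum_(k < N) t `^ (- mu k) *: chi mu q (logvec (nn k) t).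
Proof.
move=> orth; rewrite /ypart mulmx_sumr -!big_split; apply: eq_bigr => k _ /=.
have /(coeff_recursionP A GG mu_seq) qE := q_rec.
rewrite /Y /P /expansion_term -scalemxAr qE; last exact: orth.
by rewrite mulKVmx ?A_unit// !scalerDr.
Qed.

(** Induction on the number of terms. The four parts of u' + A u, where u is the
    remainder after N + 1 terms, all have decay mu (N + 1); the damped system hands
    this decay over to u. *)
Lemma remainder_decay N i : decay (mu N) (fun t => (y t - ypart N t) i 0).
Proof.
elim: N i => [|N IH] i.
  by apply: decay_near_eq (y_decay i); near=> t; rewrite /ypart big_ord0 subr0.
have [M M2 NM] := mu_natmul_ub mu_seq (mu N.+1).
pose g1 t := G (y t) - \sum_(2 <= m < M.+1) GG m (fun=> ypart N.+1 t).
pose g2 t := \sum_(2 <= m < M.+1) GG m (fun=> ypart N.+1 t)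
     - \sum_(k < N.+1) t `^ (- mu k) *: nonlin_coef GG mu q (logvec (nn k) t).
pose g3 t := f t - \sum_(k < N.+1) P k t.
pose g4 t := \sum_(k < N.+1) t `^ (- mu k) *: chi mu q (logvec (nn k) t)
   + \sum_(k < N.+1) term_deriv k t.
pose g t := g1 t + g2 t + g3 t - g4 t.
pose dypart t := \sum_(k < N.+1) term_deriv k t.
have [eta eta0 H] := damped_system_decay A_diag.
move: i; apply: (H _ (fun t => derive1 y t - dypart t) g).
- have terms : \forall t \near +oo, forall k : 'I_N.+1, forall i,
      is_derive (t : R) 1 (fun s => Y k s i 0) (term_deriv k t i 0).
    apply: filter_forall => k.
    have := expansion_term_derive mu (q_powerlike k) (leqnn _).
    by apply: filterS => t Dk i; rewrite /term_deriv mxE; exact: Dk.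
  near=> t => i; have tT : T0 < t by near: t; exact: near_pinfty_gt.
  have Dy := y_is_derive i tT.
  have Dk : forall k : 'I_N.+1, forall i,
    is_derive t 1 (fun s => Y k s i 0) (term_deriv k t i 0) by near: t.
  have Ds := is_derive_big_sum (index_enum 'I_N.+1) (fun k => Dk k i).
  have -> : (fun s => (y s - ypart N.+1 s) i 0) =
      (fun s => y s i 0) - (fun s => \sum_(k < N.+1) Y k s i 0).
    by apply/funext => s; rewrite coordB summxE.
  apply: (is_derive_eq (is_deriveB Dy Ds)).
  by rewrite coordB summxE.
- near=> t => i; have tT : T0 < t by near: t; exact: near_pinfty_gt.
  rewrite ler_wpDl ?mulr_ge0 ?norm1_ge0 ?(ltW eta0)//.
  rewrite (_ : _ + _ = g t)// /g /g1 /g2 /g3 /g4 -/(dypart t).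
  have orth : forall k, (k < N.+1)%N -> orthant (logvec (nn k) t).
    have : forall k : 'I_N.+1, orthant (logvec (nn k) t).
      by near: t; apply: filter_forall => k; exact: near_logvec_orthant.
    by move=> O k kN; exact: (O (Ordinal kN)).
  rewrite y_ode// mulmxBr (mulmx_term orth).
  set c1 := \sum_(2 <= m < M.+1) _; set c2 := \sum_(k < N.+1) _.
  set c3 := \sum_(k < N.+1) P k t; set c4 := \sum_(k < N.+1) _ *: chi _ _ _.
  set c5 := A *m _; set c6 := G _; set c7 := f t; set c8 := dypart t.
  by apply/matrixP => a b; rewrite !mxE; ring.
- move=> i; have d1 := nonlin_decay M2 NM IH i.
  have d2 := nonlin_sum_decay NM i.
  have d3 := forcing_decay N.+1 i.
  have d4 := shift_sum_decay N i.
  apply: decay_near_eq (decayB (decayD (decayD d1 d2) d3) d4).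
  by near=> t; rewrite /g /g1 /g2 /g3 /g4 !(coordB, coordD).
Unshelve. all: by end_near. Qed.

Lemma solution_expansion : asym_expansion y q mu.
Proof. by apply/(asym_expansionP y mu_homo q_powerlike); exact: remainder_decay. Qed.

End Main.

Theorem theorem5p8 (R : realType) (n : nat) (n_gt0 : (0 < n)%N)
    (A : 'M[R]_n) (A_diag : diagonalizable_pos A)
    (G : 'cV[R]_n -> 'cV[R]_n) (G_lip : locally_lipschitz G)
    (Gm : nat -> 'cV[R]_n -> 'cV[R]_n)
    (Gm_homog : forall m, (2 <= m)%N -> homogeneous_poly_map m (Gm m))
    (G_exp : nonlin_expansion G Gm)
    (GG : forall m : nat, ('I_m -> 'cV[R]_n) -> 'cV[R]_n)
    (GG_lin : forall m, (2 <= m)%N -> multilinear_map (GG m))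
    (GG_diag : forall m, (2 <= m)%N -> forall y, Gm m y = GG m (fun=> y))
    (mu : nat -> R) (mu_seq : divergent_positive_increasing mu)
    (mu_add : forall x y, range mu x -> range mu y -> range mu (x + y))
    (mu_succ : forall x, range mu x -> range mu (x + 1))
    (nn : nat -> nat) (nn_gt0 : forall k, (0 < nn k)%N)
    (nn_homo : {homo nn : i j / (i <= j)%N})
    (f : R -> 'cV[R]_n)
    (Tf : R) (Tf_ge0 : 0 <= Tf) (f_cont : {within `[Tf, +oo[, continuous f})
    (p : forall k : nat, 'rV[R]_(nn k) -> 'cV[R]_n)
    (p_powerlike : forall k, powerlike (p k))
    (f_exp : asym_expansion f p mu)
    (T0 : R) (T0_ge0 : 0 <= T0)
    (y : R -> 'cV[R]_n)
    (y_derivable : forall t, T0 < t -> derivable y t 1)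
    (y_C1 : forall t, T0 < t -> derive1 y x @[x --> t] --> derive1 y t)
    (y_ode : forall t, T0 < t -> derive1 y t = - (A *m y t) + G (y t) + f t)
    (y_to0 : y t @[t --> +oo] --> (0 : 'cV[R]_n)) :
  (exists q : forall k : nat, 'rV[R]_(nn k) -> 'cV[R]_n,
     coeff_recursion A GG mu p q) /\
  (forall q : forall k : nat, 'rV[R]_(nn k) -> 'cV[R]_n,
     coeff_recursion A GG mu p q ->
     [/\ forall k, powerlike (q k),
         forall k, (0 < k)%N -> powerlike (chi mu q (k := k)) &
         asym_expansion y q mu]).
Proof.
split; first exact: coeff_recursion_exists.
move=> q q_rec; have qP := powerlike_coefs GG_lin mu_seq p_powerlike q_rec.
split=> // [k _|]; first by apply: powerlike_chi => // l _; exact: qP.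
exact: (solution_expansion A_diag G_exp GG_lin GG_diag mu_seq mu_add mu_succ nn_homo
  p_powerlike f_exp y_derivable y_ode y_to0 q_rec).
Qed.
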